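(* Let $\{u_0^\nu\}_{\nu>0}\subset L^2(\mathbb{T}^2)$ be divergence-free vector fields such that the vorticities $\omega_0^\nu:=\operatorname{curl} u_0^\nu$ satisfy $\sup_{\nu>0}\|\omega_0^\nu\|_{\mathcal M(\mathbb{T}^2)}<\infty$. For each $\nu>0$ let $\omega^\nu$ be the (Leray) solution of the two-dimensional incompressible Navier--Stokes equations in vorticity form $$\partial_t\omega^\nu+u^\nu\cdot\nabla\omega^\nu=\nu\Delta\omega^\nu,\quad \operatorname{curl}u^\nu=\omega^\nu,\quad \omega^\nu(\cdot,0)=\omega_0^\nu$$ on $\mathbb{T}^2\times[0,\infty)$, and set $$\mathbb{M}_\omega(r):=\sup_{x\in\mathbb{T}^2,\ \nu>0,\ t>0}\int_{B_r(x)}|\omega^\nu(y,t)|\,dy,\qquad r>0.$$ (a) If there are $\alpha\in(0,2)$ and $C>0$ with $\mathbb{M}_\omega(r)\le C r^\alpha$ for all $r>0$, then there is a constant $C'>0$, independent of $\nu,t,T$, such that for all $\nu>0$ and all $t,T>0$ with $\nu t<1$ and $\nu T<1$, $$\|\omega^\nu(t)\|_{L^2}^2\le \frac{C'}{(\nu t)^{\frac{2-\alpha}{2}}}\qquad\text{and}\qquad \nu\int_0^T\|\omega^\nu(\tau)\|_{L^2}^2\,d\tau\le C'(\nu T)^{\frac{\alpha}{2}}.$$ (b) If there is $C>0$ with $\mathbb{M}_\omega(r)\le C|\log r|^{-1/2}$ for all $r\in(0,\tfrac12)$, then there is a constant $C'>0$, independent of $\nu,t$, such that $$\|\omega^\nu(t)\|_{L^2}^2\le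 \frac{C'}{\nu t\sqrt{|\log(\nu t)|}}$$ for all $\nu>0$ and all $t>0$ with $\nu t<1$. In particular, there is $C''>0$ such that for every $\delta>0$, $$\nu\int_\delta^T\|\omega^\nu(\tau)\|_{L^2}^2\,d\tau\le C''\,\frac{\log\frac{T}{\delta}}{\sqrt{|\log(\nu T)|}}$$ for all $\nu>0$ and all $T>\delta$ with $\nu T<1$, with $C''$ independent of $\nu,\delta,T$.
   Context: $\mathbb{T}^2$ is the two-dimensional flat torus and $\mathcal M(\mathbb{T}^2)$ the space of finite signed Borel measures with total variation norm. The velocity $u^\nu$ is the unique divergence-free field with $\operatorname{curl}u^\nu=\omega^\nu$ and spatial average equal to that of $u_0^\nu$. For such data the solutions exist globally, are unique and smooth for positive times. $B_r(x)$ denotes the ball of radius $r$ centered at $x$ in $\mathbb{T}^2$. *)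

(* Defs.v *)
From HB Require Import structures.
From mathcomp Require Import all_boot all_order all_algebra.
From mathcomp Require Import all_classical all_reals all_analysis.
Import Order.TTheory GRing.Theory Num.Theory.
Import numFieldNormedType.Exports.

Set Implicit Arguments.
Unset Strict Implicit.
Unset Printing Implicit Defensive.

Local Open Scope classical_set_scope.
Local Open Scope ring_scope.

(* The flat torus T^2 = R^2 / Z^2.  Functions on T^2 are represented as     *)
(* functions on R*R that are 1-periodic in each coordinate; the fundamental *)
(* domain is [0,1) x [0,1).  Space-time points are ((x1, x2), t).           *)

Section Torus.
Variable R : realType.

Definition leb2 := (@lebesgue_measure R \x @lebesgue_measure R)%E.

Definition T2dom : set (R * R) :=
  [set x | (0 <= x.1 < 1) && (0 <= x.2 < 1)].

Definition dZ (z : R) : R :=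
  Order.min (z - (Num.floor z)%:~R) ((Num.floor z)%:~R + 1 - z).

Definition tdist (x y : R * R) : R :=
  Num.sqrt (dZ (x.1 - y.1) ^+ 2 + dZ (x.2 - y.2) ^+ 2).

Definition tball (x : R * R) (r : R) : set (R * R) :=
  [set y | T2dom y /\ tdist x y < r].

Definition periodic2 (f : R * R -> R) : Prop :=
  forall x1 x2, f (x1 + 1, x2) = f (x1, x2) /\ f (x1, x2 + 1) = f (x1, x2).

Definition periodic_st (f : R * R * R -> R) : Prop :=
  forall x1 x2 t, f (x1 + 1, x2, t) = f (x1, x2, t) /\
                  f (x1, x2 + 1, t) = f (x1, x2, t).

Definition dir (i : 'I_3) : R * R * R :=
  if val i == 0%N then (1, 0, 0) else if val i == 1%N then (0, 1, 0)
  else (0, 0, 1).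

Definition pd (i : 'I_3) (f : R * R * R -> R) : R * R * R -> R :=
  fun p => 'D_(dir i) f p.

Definition dx1 := pd (@Ordinal 3 0 isT).
Definition dx2 := pd (@Ordinal 3 1 isT).
Definition dt := pd (@Ordinal 3 2 isT).

Definition ipd (s : seq 'I_3) (f : R * R * R -> R) : R * R * R -> R :=
  foldr pd f s.

Definition smooth_on (D : set (R * R * R)) (f : R * R * R -> R) : Prop :=
  forall (s : seq 'I_3) p, D p ->
    {for p, continuous (ipd s f)} /\ (forall i, derivable (ipd s f) p (dir i)).

Definition pos_time : set (R * R * R) := [set p | 0 < p.2].

Definition test_fun (phi : R * R -> R) : Prop :=
  periodic2 phi /\ smooth_on setT (fun p => phi p.1).

Definition sdx1 (phi : R * R -> R) (x : R * R) : R :=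
  dx1 (fun p => phi p.1) (x, 0).
Definition sdx2 (phi : R * R -> R) (x : R * R) : R :=
  dx2 (fun p => phi p.1) (x, 0).

(* Initial data: u0 in L^2(T^2), divergence free (in the sense of           *)
(* distributions), with curl u0 = omega0 a finite signed Borel measure on   *)
(* T^2.  The signed measure is given as the difference mup - mun of two     *)
(* finite (Borel) measures carried by the fundamental domain.               *)

Definition initial_data (u01 u02 : R * R -> R)
    (mup mun : {finite_measure set (R * R)%type -> \bar R}) : Prop :=
  [/\ periodic2 u01 /\ periodic2 u02,
      measurable_fun T2dom u01 /\ measurable_fun T2dom u02 /\
      (\int[leb2]_(x in T2dom) ((u01 x ^+ 2 + u02 x ^+ 2)%:E) < +oo)%E,
      mup (~` T2dom) = 0%E /\ mun (~` T2dom) = 0%E,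
      (forall phi, test_fun phi ->
         (\int[leb2]_(x in T2dom) ((u01 x * sdx1 phi x + u02 x * sdx2 phi x)%:E)
          = 0)%E) &
      (* curl u0 = d1 u02 - d2 u01 = omega0 in D'(T^2) *)
      (forall phi, test_fun phi ->
         (\int[leb2]_(x in T2dom) ((u01 x * sdx2 phi x - u02 x * sdx1 phi x)%:E)
          = \int[mup]_(x in T2dom) (phi x)%:E
            - \int[mun]_(x in T2dom) (phi x)%:E)%E)].

Definition ns_solution (nu : R) (w u1 u2 : R * R * R -> R)
    (u01 u02 : R * R -> R)
    (mup mun : {finite_measure set (R * R)%type -> \bar R}) : Prop :=
  [/\ (periodic_st w /\ periodic_st u1 /\ periodic_st u2) /\
      (smooth_on pos_time w /\ smooth_on pos_time u1 /\ smooth_on pos_time u2),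
      (forall p, 0 < p.2 ->
         dt w p + u1 p * dx1 w p + u2 p * dx2 w p
         = nu * (dx1 (dx1 w) p + dx2 (dx2 w) p)),
      (forall p, 0 < p.2 -> dx1 u1 p + dx2 u2 p = 0 /\
                            dx1 u2 p - dx2 u1 p = w p),
      (forall t, 0 < t ->
         (\int[leb2]_(x in T2dom) (u1 (x, t))%:E
            = \int[leb2]_(x in T2dom) (u01 x)%:E)%E /\
         (\int[leb2]_(x in T2dom) (u2 (x, t))%:E
            = \int[leb2]_(x in T2dom) (u02 x)%:E)%E) &
      (forall phi : R * R -> R, periodic2 phi -> continuous phi ->
         ((fun t => \int[leb2]_(x in T2dom) (w (x, t) * phi x)%:E) @ 0^'+
          --> (\int[mup]_(x in T2dom) (phi x)%:E
               - \int[mun]_(x in T2dom) (phi x)%:E))%E)].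

Definition L2sq (w : R * R * R -> R) (t : R) : \bar R :=
  (\int[leb2]_(x in T2dom) ((w (x, t)) ^+ 2)%:E)%E.

Definition Momega (w : R -> R * R * R -> R) (r : R) : \bar R :=
  ereal_sup [set z | exists nu x t, 0 < nu /\ 0 < t /\
     z = (\int[leb2]_(y in tball x r) (`|w nu (y, t)|)%:E)%E].

End Torus.

(* Main.v *)
(* Write y(t) for the enstrophy ||omega(t)||_2^2 and D for ||grad omega||_2^2.
   On a square Q of side l, bounding |omega(x1, x2)| once by an average in x1 and
   once by an average in x2, and multiplying, gives
     int_Q omega^2 <= 2 l^-2 (int_Q |omega|)^2 + l^2 int_Q |grad omega|^2.
   As int_Q |omega| <= M(2 l), summing over a grid of the torus gives
     y <= 2 l^-2 M(2 l) ||omega||_1 + l^2 D,   ||omega||_1 <= 64 M(1/4).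
   Insert this into y' = - 2 nu D with l^2 comparable to nu (tau - s), where
   s = t / 2: then (tau - s)^2 y(tau) - c tau is nonincreasing on [s, t] for
   c ~ M(sqrt(nu t) / 2) M(1/4) / nu, hence
     y(t) <= 2^14 M(1/4) M(sqrt(nu t) / 2) / (nu t). *)

Require Import Defs.
From HB Require Import structures.
From mathcomp Require Import all_boot all_order all_algebra.
From mathcomp Require Import all_classical all_reals all_analysis.
From mathcomp Require Import measurable_realfun ring lra.
Import Order.TTheory GRing.Theory Num.Theory.
Import numFieldNormedType.Exports.
Local Open Scope classical_set_scope.
Local Open Scope ring_scope.

Set Implicit Arguments.
Unset Strict Implicit.
Unset Printing Implicit Defensive.

(** The weight [(tau - s)^2] and the choice of [l] belong together. With [l^2] of size
    [nu (tau - s)], the gradient term of the square inequality is absorbed by the dissipation at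
    every [tau]. The derivative [2 (tau - s)] of the weight then meets [l^-2], of size
    [1 / (nu (tau - s))], and leaves a constant. Only one factor of [(int_Q |omega|)^2] is replaced
    by [M]; the other is summed over the cells. Replacing both would cost a factor [l^-2], the
    number of cells, against a mere [M]. The side of a grid must be the inverse of an integer, so
    [l] is tuned only up to a factor 2. All grids used between [s] and [t] satisfy
    [2 l <= sqrt(nu t) / 2], hence one value of [M] serves them all. As [s > 0], only times at which
    the solution is smooth enter. For [nu t < 1] both radii, [sqrt(nu t) / 2] and [1/4], lie below
    [1/2], as (b) demands. *)

(** * Measurability and integrability of continuous functions on the plane *)

Section ContinuousPlane.
Variable R : realType.
Notation mu1 := (@lebesgue_measure R).
Notation mu2 := (@leb2 R).
Notation plane := (measurableTypeR R * measurableTypeR R)%type.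
Implicit Types f g : R * R -> R.

(** The measurable sets of [plane] come from the product sigma-algebra, whereas continuity speaks of
    the product topology. A countable union of rational rectangles bridges the two. *)
Lemma continuous_plane_measurable f : continuous f ->
  measurable_fun [set: plane] f.
Proof.
move=> cf.
apply: (measurability _ (RGenOInfty.measurableE R)).
move=> /= _ [_ [c ->]] <-; rewrite setTI.
(* [F q] is the open rectangle with rational corners [q] if [f > c] throughout it, and is empty
   otherwise. *)
pose F (q : rat * rat * rat * rat) : set (R * R) :=
  [set x | (forall y : R * R,
     ratr q.1.1.1 < y.1 < ratr q.1.1.2 ->
     ratr q.1.2 < y.2 < ratr q.2 -> c < f y) /\
     ratr q.1.1.1 < x.1 < ratr q.1.1.2 /\ ratr q.1.2 < x.2 < ratr q.2].
suff -> : f @^-1` `]c, +oo[ = \bigcup_q F q.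
  apply: countable_bigcupT_measurable => // q; rewrite /F.
  set P := (forall y : R * R, _).
  have [p|np] := pselect P; last first.
    rewrite (_ : [set _ | _] = set0)//.
    by rewrite -subset0 => x /= [].
  rewrite (_ : [set _ | _] =
    `]ratr q.1.1.1, ratr q.1.1.2[%classic `*`
    `]ratr q.1.2, ratr q.2[%classic); last first.
    by apply/seteqP; split => x /=; rewrite !in_itv/=; [move=> [] | split].
  by apply: measurableX; exact: measurable_itv.
apply/seteqP; split => x /=; last first.
  by move=> [q _ [+ [x1 x2]]]; move=> /(_ x x1 x2); rewrite in_itv/= andbT.
rewrite in_itv/= andbT => cfx.
have : \forall y \near x, c < f y.
  by apply: (cf x [set y | c < y]); exact: lt_nbhsr.
move=> /nbhs_ballP[e /= e0 exy].
have [a1] := @rat_in_itvoo R (x.1 - e) x.1 ltac:(lra).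
have [b1] := @rat_in_itvoo R x.1 (x.1 + e) ltac:(lra).
have [a2] := @rat_in_itvoo R (x.2 - e) x.2 ltac:(lra).
have [b2] := @rat_in_itvoo R x.2 (x.2 + e) ltac:(lra).
rewrite !in_itv/= => /andP[? ?] /andP[? ?] /andP[? ?] /andP[? ?].
exists (a1, b1, a2, b2) => //; rewrite /F /=; split; last first.
  by split; apply/andP; split.
move=> y /andP[? ?] /andP[? ?]; apply: exy.
by split; rewrite /ball/= /ball_ ltr_norml; apply/andP; split; lra.
Qed.

Lemma continuous_plane_measurableE (A : set plane) f : continuous f ->
  measurable_fun A (EFin \o f).
Proof.
by move=> /continuous_plane_measurable mf; apply/measurable_EFinP;
  apply: measurable_funTS.
Qed.

Lemma T2domE : @T2dom R = `[0, 1[%classic `*` `[0, 1[%classic.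
Proof.
by apply/seteqP; split => x /=; rewrite !in_itv/=; [move=> /andP | move=> /andP].
Qed.

Lemma measurable_T2dom : @measurable _ plane (@T2dom R).
Proof. by rewrite T2domE; apply: measurableX; exact: measurable_itv. Qed.

Lemma leb2_T2dom : (mu2 (@T2dom R) = 1)%E.
Proof.
rewrite T2domE /leb2 product_measure1E; [|exact: measurable_itv..].
by rewrite /= lebesgue_measure_itv/= lte_fin ltr01 oppr0 adde0 mule1.
Qed.

Lemma continuous_bounded_square f : continuous f ->
  exists2 M, 0 < M & forall x, T2dom x -> `|f x| <= M.
Proof.
move=> cf.
have : compact (f @` (`[0, 1]%classic `*` `[0, 1]%classic)).
  apply: continuous_compact; first exact: continuous_subspaceT.
  by apply: compact_setX; exact: segment_compact.
move=> /compact_bounded [M [_ hM]].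
exists (`|M| + 1); first by rewrite ltr_wpDl.
move=> x /andP[/andP[? ?] /andP[? ?]]; apply: (hM (`|M| + 1)).
  by rewrite (le_lt_trans (ler_norm _))// ltrDl.
by exists x => //; split; rewrite /= in_itv/=; apply/andP; split => //; exact: ltW.
Qed.

Lemma continuous_plane_integrable (A : set plane) f :
  measurable A -> A `<=` @T2dom R -> continuous f ->
  mu2.-integrable A (EFin \o f).
Proof.
move=> mA AT cf; apply: (@integrableS _ _ _ _ _ _ _ measurable_T2dom mA AT).
apply: measurable_bounded_integrable => //.
- exact: measurable_T2dom.
- apply: (@le_lt_trans _ _ 1%E); last exact: ltry.
  by rewrite le_eqVlt; apply/orP; left; apply/eqP; exact: leb2_T2dom.
- by apply: measurable_funTS; exact: continuous_plane_measurable.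
- have [M M0 hM] := continuous_bounded_square cf.
  exists M; split; first exact: num_real.
  move=> z Mz x /= /hM /le_trans; apply; exact: ltW.
Qed.

End ContinuousPlane.

(** * Iterated integrals over a rectangle inside the fundamental domain *)

Section FubiniRectangle.
Variable R : realType.
Notation mu1 := (@lebesgue_measure R).
Notation mu2 := (@leb2 R).
Notation plane := (measurableTypeR R * measurableTypeR R)%type.
Variables (I J : set (measurableTypeR R)) (f : R * R -> R).
Hypotheses (mI : measurable I) (mJ : measurable J).
Hypotheses (I01 : I `<=` `[0, 1[) (J01 : J `<=` `[0, 1[).
Hypothesis cf : continuous f.

Let mIJ : @measurable _ plane (I `*` J).
Proof. exact: measurableX. Qed.

Lemma rectangle_subT2 : I `*` J `<=` @T2dom R.
Proof. by rewrite T2domE => x [/I01 ? /J01 ?]; split. Qed.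

Lemma rectangle_integrable : mu2.-integrable (I `*` J) (EFin \o f).
Proof. exact: continuous_plane_integrable mIJ rectangle_subT2 cf. Qed.

(** Fubini is applied on the whole plane, hence the extension by zero; [FE] and [GE] show that its
    section integrals are zero extensions too. *)
Let g : plane -> \bar R := (EFin \o f) \_ (I `*` J).

Let ig : mu2.-integrable setT g.
Proof.
by apply/(integrable_mkcond _ mIJ); exact: rectangle_integrable.
Qed.

Let gE x y : g (x, y) = (if (x \in I) && (y \in J) then (f (x, y))%:E else 0%E).
Proof. by rewrite /g patchE in_setX. Qed.

Let FE : fubini_F mu1 g =
  (fun x => \int[mu1]_(y in J) (f (x, y))%:E)%E \_ I.
Proof.
apply/funext => x; rewrite /fubini_F patchE.
case: ifPn => xI.
  rewrite [RHS]integral_mkcond; apply: eq_integral => y _.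
  by rewrite gE xI patchE.
by rewrite integral0_eq// => y _; rewrite gE (negbTE xI).
Qed.

Let GE : fubini_G mu1 g =
  (fun y => \int[mu1]_(x in I) (f (x, y))%:E)%E \_ J.
Proof.
apply/funext => y; rewrite /fubini_G patchE.
case: ifPn => yJ.
  rewrite [RHS]integral_mkcond; apply: eq_integral => x _.
  by rewrite gE yJ andbT patchE.
by rewrite integral0_eq// => x _; rewrite gE (negbTE yJ) andbF.
Qed.

Lemma rectangle_measurable1 :
  measurable_fun I (fun x => \int[mu1]_(y in J) (f (x, y))%:E)%E.
Proof.
apply/(measurable_restrictT _ mI); rewrite -FE.
exact: measurable_fubini_F ig.
Qed.

Lemma rectangle_measurable2 :
  measurable_fun J (fun y => \int[mu1]_(x in I) (f (x, y))%:E)%E.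
Proof.
apply/(measurable_restrictT _ mJ); rewrite -GE.
exact: measurable_fubini_G ig.
Qed.

Lemma rectangle_integral1 :
  (\int[mu2]_(p in I `*` J) (f p)%:E =
   \int[mu1]_(x in I) \int[mu1]_(y in J) (f (x, y))%:E)%E.
Proof.
rewrite integral_mkcond -(integral12_prod_meas1 ig) FE.
by rewrite -integral_mkcond.
Qed.

Lemma rectangle_integral2 :
  (\int[mu2]_(p in I `*` J) (f p)%:E =
   \int[mu1]_(y in J) \int[mu1]_(x in I) (f (x, y))%:E)%E.
Proof.
rewrite integral_mkcond -(integral21_prod_meas1 ig) GE.
by rewrite -integral_mkcond.
Qed.

End FubiniRectangle.

Lemma EFin_Rintegral_integrable d (T : measurableType d) (R : realType)
    (mu : {measure set T -> \bar R}) (D : set T) (f : T -> R) :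
  measurable D -> mu.-integrable D (EFin \o f) ->
  ((\int[mu]_(x in D) f x)%R%:E = \int[mu]_(x in D) (f x)%:E)%E.
Proof. by move=> mD fi; rewrite /Rintegral fineK// integrable_fin_num. Qed.

(** * One-dimensional Sobolev bound on an interval *)

Section Interval.
Variable R : realType.
Notation mu1 := (@lebesgue_measure R).
Variables (g g' : R -> R).
Hypothesis dg : forall x : R, is_derive x (1 : R) g (g' x).
Hypothesis cg' : continuous g'.

Let cg : continuous g.
Proof.
by move=> x; apply: differentiable_continuous; apply/derivable1_diffP; case: (dg x).
Qed.

Lemma continuous_interval_integrable (h : R -> R) a b : continuous h ->
  mu1.-integrable `[a, b[ (EFin \o h).
Proof.
move=> ch; apply: (@integrableS _ _ _ mu1 `[a, b]%classic) => //.
- exact: subset_itv_co_cc.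
- apply: continuous_compact_integrable; first exact: segment_compact.
  exact: continuous_subspaceT.
Qed.

Lemma FTC2_lt x y : x < y ->
  (\int[mu1]_(z in `[x, y]) (g' z)%:E = (g y - g x)%:E)%E.
Proof.
move=> xy; rewrite EFinB.
apply: (@continuous_FTC2 R g' g x y xy).
- exact: continuous_subspaceT.
- split.
  + by move=> z _; case: (dg z).
  + by apply: cvg_at_right_filter; exact: cg.
  + by apply: cvg_at_left_filter; exact: cg.
- by move=> z _; rewrite derive1E; case: (dg z).
Qed.

Let incr a b x y : a <= x -> x < y -> y < b ->
  `|g y - g x| <= \int[mu1]_(z in `[a, b[) `|g' z|.
Proof.
move=> ax xy yb.
have mg A : measurable_fun A (EFin \o g').
  by apply/measurable_EFinP; apply: measurable_funTS; apply: continuous_measurable_fun.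
rewrite -lee_fin EFin_Rintegral_integrable//; last first.
  apply: (@continuous_interval_integrable (fun z => `|g' z|)) => z.
  by apply: continuous_comp; [exact: cg'|exact: norm_continuous].
have := @FTC2_lt _ _ xy => E.
rewrite -abse_EFin -E.
have h := @le_abse_integral _ _ _ mu1 _ _ (measurable_itv `[x, y]) (mg `[x, y]%classic).
apply: le_trans h _.
apply: ge0_subset_integral => //.
  by apply: measurableT_comp => //; exact: mg.
move=> z /=; rewrite !in_itv/= => /andP[? ?]; apply/andP; split; lra.
Qed.

(** With [M] the integral of [|g'|], [|g x| <= |g z| + M] for every [z] of the interval; averaging
    over [z] produces the factor [l^-1]. *)
Lemma interval_sup_le a l x : 0 < l -> a <= x < a + l ->
  `|g x| <= \int[mu1]_(z in `[a, a + l[) (l^-1 * `|g z| + `|g' z|).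
Proof.
move=> l0 /andP[ax xl].
set I := `[a, a + l[%classic.
have mI : measurable I by exact: measurable_itv.
have cn (h : R -> R) : continuous h -> continuous (fun z => `|h z|).
  by move=> ch z; apply: continuous_comp; [exact: ch|exact: norm_continuous].
have ig : mu1.-integrable I (EFin \o (fun z => `|g z|)).
  by apply: continuous_interval_integrable; exact: cn.
have ig' : mu1.-integrable I (EFin \o (fun z => `|g' z|)).
  by apply: continuous_interval_integrable; exact: cn.
have ic c : mu1.-integrable I (EFin \o (fun=> c)).
  by apply: continuous_interval_integrable => z; exact: cvg_cst.
have ilg : mu1.-integrable I (EFin \o (fun z => l^-1 * `|g z|)).
  by apply: continuous_interval_integrable => z; apply: cvgMr; exact: cn.
have cstE c : \int[mu1]_(z in I) c = c * l.
  rewrite /Rintegral integral_cst//= lebesgue_measure_itv/= lte_fin ltrDl l0.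
  by rewrite -EFinB -EFinM/=; congr (_ * _); lra.
set M := \int[mu1]_(z in I) `|g' z|.
have : \int[mu1]_(z in I) `|g x| <= \int[mu1]_(z in I) (`|g z| + M).
  apply: le_Rintegral => //.
    by apply: continuous_interval_integrable => z; apply: cvgD; [exact: cn|exact: cvg_cst].
  move=> z; rewrite /I /= in_itv/= => /andP[az zl].
  have : `|g x - g z| <= M.
    have [xz|zx|->] := ltgtP x z.
    - by rewrite distrC; exact: incr.
    - exact: incr.
    - by rewrite subrr normr0; apply: Rintegral_ge0.
  move=> h; rewrite -[g x](subrK (g z)) (le_trans (ler_normD _ _))//.
  by rewrite addrC lerD2l.
rewrite cstE RintegralD// cstE RintegralD// RintegralZl// -/M => h.
rewrite -(ler_pM2r l0) mulrDl -[l^-1 * _ * l]mulrAC mulVf ?mul1r//; lra.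
Qed.

End Interval.

Lemma continuous_normr (R : realType) (T : topologicalType) (h : T -> R) :
  continuous h -> continuous (fun z => `|h z|).
Proof. by move=> ch z; apply: cvg_norm; exact: ch. Qed.

Lemma continuous_slice1 (R : realType) (f : R * R -> R) y :
  continuous f -> continuous (fun x => f (x, y)).
Proof.
move=> cf x; apply: (@continuous_comp _ _ _ (fun x => (x, y)) f); last exact: cf.
by apply: (@cvg_pair _ _ _ _ (nbhs x) (nbhs y)); [exact: cvg_id|exact: cvg_cst].
Qed.

Lemma continuous_slice2 (R : realType) (f : R * R -> R) x :
  continuous f -> continuous (fun y => f (x, y)).
Proof.
move=> cf y; apply: (@continuous_comp _ _ _ (fun y => (x, y)) f); last exact: cf.
by apply: (@cvg_pair _ _ _ _ (nbhs x) (nbhs y)); [exact: cvg_cst|exact: cvg_id].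
Qed.

(** * The L2 inequality on one square *)

Section Square.
Variable R : realType.
Notation mu1 := (@lebesgue_measure R).
Notation mu2 := (@leb2 R).
Variables (f f1 f2 : R * R -> R) (a b l : R).
Hypotheses (cf : continuous f) (cf1 : continuous f1) (cf2 : continuous f2).
Hypothesis df1 : forall x y : R, is_derive x (1 : R) (fun z => f (z, y)) (f1 (x, y)).
Hypothesis df2 : forall x y : R, is_derive y (1 : R) (fun z => f (x, z)) (f2 (x, y)).
Hypotheses (a0 : 0 <= a) (b0 : 0 <= b) (l0 : 0 < l).
Hypotheses (al1 : a + l <= 1) (bl1 : b + l <= 1).

Let I := `[a, a + l[%classic : set (measurableTypeR R).
Let J := `[b, b + l[%classic : set (measurableTypeR R).
Let Q := I `*` J.

Let mI : measurable I. Proof. exact: measurable_itv. Qed.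
Let mJ : measurable J. Proof. exact: measurable_itv. Qed.
Let I01 : I `<=` `[0, 1[.
Proof.
move=> x; rewrite /I /= !in_itv/= => /andP[h1 h2].
by rewrite (le_trans a0 h1) (lt_le_trans h2 al1).
Qed.
Let J01 : J `<=` `[0, 1[.
Proof.
move=> x; rewrite /J /= !in_itv/= => /andP[h1 h2].
by rewrite (le_trans b0 h1) (lt_le_trans h2 bl1).
Qed.
Let mQ : measurable Q. Proof. exact: measurableX. Qed.
Let iQ (h : R * R -> R) : continuous h -> mu2.-integrable Q (EFin \o h).
Proof. exact: rectangle_integrable. Qed.

Let H1 p := l^-1 * `|f p| + `|f1 p|.
Let H2 p := l^-1 * `|f p| + `|f2 p|.

Let cH (h : R * R -> R) : continuous h ->
  continuous (fun p => l^-1 * `|f p| + `|h p|).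
Proof.
move=> ch p; apply: cvgD; last exact: continuous_normr.
by apply: cvgMr; exact: continuous_normr.
Qed.

Let H1_ge0 p : 0 <= H1 p.
Proof. by rewrite addr_ge0// mulr_ge0// invr_ge0 ltW. Qed.

Let H2_ge0 p : 0 <= H2 p.
Proof. by rewrite addr_ge0// mulr_ge0// invr_ge0 ltW. Qed.

Let alpha y := (\int[mu1]_(x in I) (H1 (x, y))%:E)%E.
Let beta x := (\int[mu1]_(y in J) (H2 (x, y))%:E)%E.

Let alpha_ge0 y : (0 <= alpha y)%E.
Proof. by apply: integral_ge0 => x _; rewrite lee_fin. Qed.

Let beta_ge0 x : (0 <= beta x)%E.
Proof. by apply: integral_ge0 => y _; rewrite lee_fin. Qed.

Let f_le_alpha x y : I x -> ((`|f (x, y)|)%:E <= alpha y)%E.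
Proof.
rewrite /I /= in_itv/= => xI.
have := @interval_sup_le R (fun x => f (x, y)) (fun x => f1 (x, y))
  (fun x => df1 x y) (continuous_slice1 cf1) a l x l0 xI.
rewrite -lee_fin EFin_Rintegral_integrable//.
apply: (@continuous_interval_integrable _ (fun x => H1 (x, y))).
exact: continuous_slice1 (cH cf1).
Qed.

Let f_le_beta x y : J y -> ((`|f (x, y)|)%:E <= beta x)%E.
Proof.
rewrite /J /= in_itv/= => yJ.
have := @interval_sup_le R (fun y => f (x, y)) (fun y => f2 (x, y))
  (fun y => df2 x y) (continuous_slice2 cf2) b l y l0 yJ.
rewrite -lee_fin EFin_Rintegral_integrable//.
apply: (@continuous_interval_integrable _ (fun y => H2 (x, y))).
exact: continuous_slice2 (cH cf2).
Qed.

Let csq (h : R * R -> R) : continuous h -> continuous (fun p => h p ^+ 2).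
Proof. by move=> ch p; apply: continuousM; exact: ch. Qed.

(* [f ^ 2 <= alpha(y) beta(x)] on [Q], a product of functions of one variable. *)
Let square_le_prod :
  (\int[mu2]_(p in Q) (f p ^+ 2)%:E <=
   (\int[mu2]_(p in Q) (H1 p)%:E) * (\int[mu2]_(p in Q) (H2 p)%:E))%E.
Proof.
have ma := rectangle_measurable2 mI mJ I01 J01 (cH cf1).
have mb := rectangle_measurable1 mI mJ I01 J01 (cH cf2).
rewrite (rectangle_integral1 mI mJ I01 J01 (csq cf)).
rewrite (rectangle_integral2 mI mJ I01 J01 (cH cf1)).
rewrite (rectangle_integral1 mI mJ I01 J01 (cH cf2)).
have a0' : (0 <= \int[mu1]_(y in J) alpha y)%E by exact: integral_ge0.
rewrite -(ge0_integralZl mu1 mI mb (fun x _ => beta_ge0 x) a0').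
apply: ge0_le_integral => //.
- by move=> x _; apply: integral_ge0 => y _; rewrite lee_fin sqr_ge0.
- exact: (rectangle_measurable1 mI mJ I01 J01 (csq cf)).
- by apply: emeasurable_funM => //; exact: mb.
move=> x Ix; rewrite muleC.
rewrite -/(beta x) -(ge0_integralZl mu1 mJ ma (fun y _ => alpha_ge0 y) (beta_ge0 x)).
apply: ge0_le_integral => //.
- by move=> y _; rewrite lee_fin sqr_ge0.
- apply/measurable_EFinP; apply: measurable_funTS.
  apply: continuous_measurable_fun; exact: continuous_slice2 (csq cf).
- exact: measurable_funeM.
move=> y Jy; rewrite -(real_normK (num_real (f (x, y)))) expr2 EFinM.
by apply: lee_pmul => //; [exact: f_le_beta|exact: f_le_alpha].
Qed.

Let leb2Q : (\int[mu2]_(p in Q) (1 : R))%R = l ^+ 2.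
Proof.
have E : (mu2 Q = (l ^+ 2)%:E)%E.
  rewrite /Q /leb2 product_measure1E//=.
  rewrite !lebesgue_measure_itv/= !lte_fin !ltrDl l0 -!EFinB -EFinM/=.
  by congr (_%:E); ring.
transitivity (fine (mu2 Q)); last by rewrite E.
by rewrite /Rintegral integral_cst// mul1e.
Qed.

(* Expand [0 <= int_Q (h - c)^2] at the mean value [c] of [h]. *)
Let cauchy_schwarz (h : R * R -> R) : continuous h ->
  (\int[mu2]_(p in Q) h p)%R ^+ 2 <= l ^+ 2 * (\int[mu2]_(p in Q) (h p ^+ 2))%R.
Proof.
move=> ch; set A := (\int[mu2]_(p in Q) h p)%R; set B := (X in _ * X).
pose c := A / l ^+ 2.
have : 0 <= (\int[mu2]_(p in Q) ((h p ^+ 2 + (- (2 * c)) * h p) + c ^+ 2 * 1))%R.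
  by apply: Rintegral_ge0 => p _; have := sqr_ge0 (h p - c); lra.
have c1 : continuous (fun p : R * R => - (2 * c) * h p).
  by move=> p; apply: cvgMr; exact: ch.
have c2 : continuous (fun _ : R * R => c ^+ 2 * 1).
  by move=> p; exact: cvg_cst.
have c0 : continuous (fun _ : R * R => 1 : R) by move=> p; exact: cvg_cst.
rewrite RintegralD//; last 2 first.
- apply: (@iQ (fun p => h p ^+ 2 + - (2 * c) * h p)) => p.
  by apply: cvgD; [exact: csq|exact: c1].
- exact: (iQ c2).
rewrite RintegralD//; last 2 first.
- exact: iQ (csq ch).
- exact: iQ c1.
rewrite RintegralZl//; last exact: iQ ch.
rewrite RintegralZl//; last exact: iQ c0.
rewrite leb2Q -/A -/B /c => h0.
have l2 : 0 < l ^+ 2 by rewrite exprn_gt0.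
have -> : A ^+ 2 = l ^+ 2 * (A ^+ 2 / l ^+ 2).
  by rewrite mulrC divfK// gt_eqF.
rewrite ler_pM2l//.
have E : (A / l ^+ 2) ^+ 2 * l ^+ 2 = A ^+ 2 / l ^+ 2.
  by field; rewrite gt_eqF.
have E2 : - (2 * (A / l ^+ 2)) * A = - 2 * (A ^+ 2 / l ^+ 2).
  by field; rewrite gt_eqF.
rewrite E E2 in h0; lra.
Qed.

(** Write [k] for [l^-1] times the L1 norm of [f] and [B1], [B2] for the L1 norms of [f1], [f2]. The
    product bound is [(k + B1) (k + B2) <= 2 k^2 + B1^2 + B2^2], and Cauchy-Schwarz on a square of
    area [l^2] turns each [Bi^2] into [l^2] times an L2 integral. *)
Lemma square_L2_le :
  (\int[mu2]_(p in Q) (f p ^+ 2))%R <=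
  2 / l ^+ 2 * (\int[mu2]_(p in Q) `|f p|)%R ^+ 2 +
  l ^+ 2 * (\int[mu2]_(p in Q) (f1 p ^+ 2 + f2 p ^+ 2))%R.
Proof.
have := square_le_prod.
rewrite -!EFin_Rintegral_integrable//; try exact: iQ (csq cf);
  try exact: iQ (cH _).
rewrite -EFinM lee_fin => /le_trans; apply.
have HE (h : R * R -> R) : continuous h -> (\int[mu2]_(p in Q) (l^-1 * `|f p| + `|h p|))%R =
    l^-1 * (\int[mu2]_(p in Q) `|f p|)%R + (\int[mu2]_(p in Q) `|h p|)%R.
  move=> ch; rewrite RintegralD//.
  - by rewrite RintegralZl//; exact: iQ (continuous_normr cf).
  - apply: (@iQ (fun p => l^-1 * `|f p|)) => p.
    by apply: cvgMr; exact: continuous_normr.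
  - exact: iQ (continuous_normr ch).
rewrite /H1 /H2 !HE// RintegralD//; try exact: iQ (csq _).
have CS (h : R * R -> R) : continuous h -> (\int[mu2]_(p in Q) `|h p|)%R ^+ 2 <=
    l ^+ 2 * (\int[mu2]_(p in Q) (h p ^+ 2))%R.
  move=> ch; apply: le_trans (cauchy_schwarz (continuous_normr ch)) _.
  rewrite le_eqVlt; apply/orP; left; apply/eqP; congr (_ * _).
  by apply: eq_Rintegral => p _; rewrite real_normK ?num_real.
have := CS _ cf1; have := CS _ cf2.
set A := (\int[mu2]_(p in Q) `|f p|)%R.
set B1 := (\int[mu2]_(p in Q) `|f1 p|)%R.
set B2 := (\int[mu2]_(p in Q) `|f2 p|)%R.
move=> h2 h1.
rewrite mulrDr.
have -> : 2 / l ^+ 2 * A ^+ 2 = 2 * (l^-1 * A) ^+ 2 by field; rewrite gt_eqF.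
set k := l^-1 * A.
(* The defect in [(k + B1) (k + B2) <= 2 k^2 + B1^2 + B2^2] is half the sum of these three
   squares. *)
have := sqr_ge0 (k - B1); have := sqr_ge0 (k - B2).
have := sqr_ge0 (B1 - B2); nra.
Qed.

End Square.

(* Read off the supremum over simple functions: [B] will be a ball [tball x r],
   whose measurability is never established. *)
Lemma ge0_le_integral_subset d (T : measurableType d) (R : realType)
    (mu : {measure set T -> \bar R}) (A B : set T) (f : T -> \bar R) :
  (forall x, 0 <= f x)%E -> A `<=` B ->
  (\int[mu]_(x in A) f x <= \int[mu]_(x in B) f x)%E.
Proof.
move=> f0 AB; rewrite integral_mkcond [leRHS]integral_mkcond.
rewrite !ge0_integralTE; try by move=> x; apply: erestrict_ge0.
apply: ereal_sup_le => _ [h /= hf <-]; exists h => //= x.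
by apply: le_trans (hf x) _; apply: restrict_lee.
Qed.

(** * Upper bounds for the distance on the torus *)

Section TorusDistance.
Variable R : realType.

Lemma dZ_ge0 (z : R) : 0 <= dZ z.
Proof.
have /andP[h1 h2] := floor_itv z; rewrite /dZ le_min !subr_ge0 h1/=.
by rewrite ltW//; move: h2; rewrite intrD.
Qed.

(** [dZ] is the distance to the nearest integer. For [|z| < 1] the floor is 0 or -1, and in both
    cases one argument of the minimum is the distance to 0. *)
Lemma dZ_le_norm (z : R) : `|z| < 1 -> dZ z <= `|z|.
Proof.
move=> z1; have [z0|z0] := leP 0 z.
  rewrite /dZ (@floor_def _ z 0) ?subr0 ?ge_min ?ler_norm//.
  by rewrite add0r z0/= (le_lt_trans (ler_norm _) z1).
rewrite /dZ (@floor_def _ z (-1)); last first.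
  by rewrite addNr z0 andbT; move: z1; rewrite ltr0_norm//; lra.
by rewrite ltr0_norm// ge_min; apply/orP; right; lra.
Qed.

(** The factor 2 is a convenient majorant of the square root of 2; it is the reason why balls of
    radius [2 l] are attached to squares of side [l]. *)
Lemma tdist_lt (l : R) (x y : R * R) : l <= 1 ->
  `|x.1 - y.1| < l -> `|x.2 - y.2| < l -> tdist x y < 2 * l.
Proof.
move=> l1 h1 h2.
have l0 : 0 < l by exact: le_lt_trans (normr_ge0 _) h1.
have d1 := le_lt_trans (dZ_le_norm (lt_le_trans h1 l1)) h1.
have d2 := le_lt_trans (dZ_le_norm (lt_le_trans h2 l1)) h2.
have e1 := dZ_ge0 (x.1 - y.1); have e2 := dZ_ge0 (x.2 - y.2).
rewrite /tdist -(ltr_pXn2r (ltn0Sn 1)) ?nnegrE ?sqrtr_ge0//; last by lra.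
rewrite sqr_sqrtr ?addr_ge0 ?sqr_ge0//; nra.
Qed.

End TorusDistance.

(** * Summation over a grid of squares covering the torus *)

Section Grid.
Variable R : realType.
Variable m : nat.
Notation mu2 := (@leb2 R).
Let n := m.+1.
Let l : R := n%:R^-1.

Definition grid_cell (i : nat) : set (measurableTypeR R) :=
  `[i%:R * l, i%:R * l + l[%classic.
Definition grid_square (p : 'I_n * 'I_n) := grid_cell p.1 `*` grid_cell p.2.

Let n0 : 0 < n%:R :> R. Proof. by rewrite ltr0n. Qed.
Let l0 : 0 < l. Proof. by rewrite invr_gt0. Qed.

(** Naming the cell of a point by a function of the point gives covering and disjointness at once.
    [0 <= x] must be kept, since [truncn] sends negative numbers to 0. *)
Lemma grid_cellP i (x : R) :
  grid_cell i x <-> 0 <= x /\ Num.truncn (x * n%:R) = i.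
Proof.
have E : ((i%:R * l <= x) && (x < i%:R * l + l)) =
    (i%:R <= x * n%:R < i.+1%:R).
  have -> : i%:R * l + l = i.+1%:R * l by rewrite -natr1 mulrDl mul1r.
  by rewrite /l ler_pdivrMr// ltr_pdivlMr.
rewrite /grid_cell /= in_itv/= E; split => [h|[x0 <-]].
  split; last exact: truncn_def.
  case/andP: h => h _; rewrite -(pmulr_lge0 _ n0).
  by rewrite (le_trans _ h).
by apply: truncn_itv; rewrite mulr_ge0.
Qed.

Lemma grid_square_measurable p : measurable (grid_square p).
Proof. by apply: measurableX; exact: measurable_itv. Qed.

Lemma grid_cell_bound (i : 'I_n) : 0 <= i%:R * l /\ i%:R * l + l <= 1.
Proof.
split; first by rewrite mulr_ge0// ltW.
have -> : i%:R * l + l = i.+1%:R * l by rewrite -natr1 mulrDl mul1r.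
by rewrite /l ler_pdivrMr// mul1r ler_nat.
Qed.

Lemma T2dom_grid : @T2dom R =
  \big[setU/set0]_(p <- index_enum ('I_n * 'I_n)%type) grid_square p.
Proof.
rewrite -bigcup_seq; apply/seteqP; split => [x|x [[i j] _ [/= h1 h2]]].
  move=> /andP[/andP[x0 x1] /andP[y0 y1]].
  have t1 (z : R) : 0 <= z -> z < 1 -> (Num.truncn (z * n%:R) < n)%N.
    move=> z0 z1; rewrite truncn_lt_nat; last by rewrite mulr_ge0.
    by rewrite gtr_pMl.
  exists (Ordinal (t1 _ x0 x1), Ordinal (t1 _ y0 y1)).
    by rewrite /= mem_index_enum.
  by split; apply/grid_cellP.
have [a0 a1] := grid_cell_bound i; have [b0 b1] := grid_cell_bound j.
move: h1 h2; rewrite /grid_cell /= !in_itv/= => /andP[p q] /andP[r s].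
by rewrite /T2dom /= (le_trans a0 p) (le_trans b0 r) (lt_le_trans q a1)
  (lt_le_trans s b1).
Qed.

Lemma trivIset_grid : trivIset [set` index_enum ('I_n * 'I_n)%type] grid_square.
Proof.
move=> [i j] [i' j'] _ _ [x [[/= h1 h2] [/= h3 h4]]].
move/grid_cellP : h1 => [_ e1]; move/grid_cellP : h2 => [_ e2].
move/grid_cellP : h3 => [_ e3]; move/grid_cellP : h4 => [_ e4].
by congr (_, _); apply: val_inj; rewrite /= -?e1 -?e2 -?e3 -?e4.
Qed.

Lemma grid_square_sub p : grid_square p `<=` @T2dom R.
Proof.
by move=> x px; rewrite T2dom_grid -bigcup_seq; exists p => //=;
  rewrite mem_index_enum.
Qed.

Lemma grid_integral (h : R * R -> R) : continuous h -> (forall x, 0 <= h x) ->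
  \int[mu2]_(x in @T2dom R) h x =
  \sum_(p : 'I_n * 'I_n) \int[mu2]_(x in grid_square p) h x.
Proof.
move=> ch h0; apply: EFin_inj; rewrite -sumEFin.
rewrite EFin_Rintegral_integrable; last 2 first.
- exact: measurable_T2dom.
- by apply: continuous_plane_integrable => //; exact: measurable_T2dom.
rewrite {1}T2dom_grid ge0_integral_bigsetU//=.
- apply: eq_bigr => p _; rewrite EFin_Rintegral_integrable//.
    exact: grid_square_measurable.
  apply: continuous_plane_integrable => //.
    exact: grid_square_measurable.
  exact: grid_square_sub.
- exact: grid_square_measurable.
- exact: index_enum_uniq.
- exact: trivIset_grid.
- exact: continuous_plane_measurableE.
- by move=> x _; rewrite lee_fin.
Qed.

Lemma grid_square_le_ball (h : R * R -> R) (r B : R) p : continuous h ->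
  2 * l <= r ->
  (forall x, \int[mu2]_(y in tball x r) (`|h y|)%:E <= B%:E)%E ->
  \int[mu2]_(x in grid_square p) `|h x| <= B.
Proof.
move=> ch lr hB; rewrite -lee_fin EFin_Rintegral_integrable; last 2 first.
- exact: grid_square_measurable.
- apply: continuous_plane_integrable.
  + exact: grid_square_measurable.
  + exact: grid_square_sub.
  + exact: continuous_normr.
(* The ball is centred at the lower left corner, so that both coordinate differences lie in
   [[0, l)]. *)
apply: le_trans (hB (p.1%:R * l, p.2%:R * l)).
apply: ge0_le_integral_subset => // y py; split; first exact: grid_square_sub py.
apply: lt_le_trans lr; apply: tdist_lt.
- by rewrite /l invf_le1// ler1n.
- case: py => + _; rewrite /grid_cell /= in_itv/= => /andP[h1 h2].
  by rewrite distrC ger0_norm ?subr_ge0// ltrBlDl.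
- case: py => _; rewrite /grid_cell /= in_itv/= => /andP[h1 h2].
  by rewrite distrC ger0_norm ?subr_ge0// ltrBlDl.
Qed.

Lemma torus_L1_le (h : R * R -> R) (r B : R) : continuous h -> 2 * l <= r ->
  (forall x, \int[mu2]_(y in tball x r) (`|h y|)%:E <= B%:E)%E ->
  \int[mu2]_(x in @T2dom R) `|h x| <= n%:R ^+ 2 * B.
Proof.
move=> ch lr hB; rewrite grid_integral//; last exact: continuous_normr.
apply: (@le_trans _ _ (\sum_(p : 'I_n * 'I_n) B)).
  by apply: ler_sum => p _; exact: grid_square_le_ball ch lr hB.
by rewrite sumr_const card_prod card_ord -[_ *+ _]mulr_natl natrM expr2.
Qed.

(** In each cell one factor of the squared L1 norm is bounded by [B]; the other is kept, and these
    add up to the L1 norm on the torus. *)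
Lemma torus_L2_le (f f1 f2 : R * R -> R) (r B : R) :
  continuous f -> continuous f1 -> continuous f2 ->
  (forall x y : R, is_derive x (1 : R) (fun z => f (z, y)) (f1 (x, y))) ->
  (forall x y : R, is_derive y (1 : R) (fun z => f (x, z)) (f2 (x, y))) ->
  2 * l <= r ->
  (forall x, \int[mu2]_(y in tball x r) (`|f y|)%:E <= B%:E)%E ->
  \int[mu2]_(x in @T2dom R) (f x ^+ 2) <=
  2 / l ^+ 2 * B * \int[mu2]_(x in @T2dom R) `|f x| +
  l ^+ 2 * \int[mu2]_(x in @T2dom R) (f1 x ^+ 2 + f2 x ^+ 2).
Proof.
move=> cf cf1 cf2 df1 df2 lr hB.
have csq (h : R * R -> R) : continuous h -> continuous (fun p => h p ^+ 2).
  by move=> ch p; apply: continuousM; exact: ch.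
have csum : continuous (fun p => f1 p ^+ 2 + f2 p ^+ 2).
  by move=> p; apply: cvgD; exact: csq.
rewrite (grid_integral (csq _ cf)); last by move=> p; rewrite sqr_ge0.
rewrite (grid_integral (continuous_normr cf))//.
rewrite (grid_integral csum); last by move=> p; rewrite addr_ge0 ?sqr_ge0.
rewrite !mulr_sumr -big_split/=; apply: ler_sum => -[i j] _.
have [a0 a1] := grid_cell_bound i; have [b0 b1] := grid_cell_bound j.
have := square_L2_le cf cf1 cf2 df1 df2 a0 b0 l0 a1 b1.
move/le_trans; apply; rewrite lerD2r -[_ * B * _]mulrA ler_wpM2l//.
  by rewrite divr_ge0// sqr_ge0.
rewrite expr2 ler_wpM2r//; first exact: Rintegral_ge0.
exact: (grid_square_le_ball (i, j) cf lr hB).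
Qed.

End Grid.

(** * From directional derivatives in space-time to derivatives in one variable *)

Section PartialDerivatives.
Variable R : realType.
Implicit Types (F : R * R * R -> R) (x y t : R).

(** Only derivability along a coordinate direction is at hand, so instead of a chain rule the two
    difference quotients are shown to be the same function of [h]. *)
Lemma is_derive_dx1 F x y t :
  derivable F (x, y, t) (dir R (@Ordinal 3 0 isT)) ->
  is_derive x (1 : R) (fun z => F (z, y, t)) (dx1 F (x, y, t)).
Proof.
have E : (fun h : R => h^-1 *:
      (((fun z => F (z, y, t)) \o shift x) (h *: (1 : R)) - F (x, y, t))) =
    (fun h => h^-1 *: ((F \o shift (x, y, t)) (h *: dir R (@Ordinal 3 0 isT))
      - F (x, y, t))).
  apply/funext => h; congr (_ *: (_ - _)); rewrite /= /dir/=; congr F.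
  by congr (_, _, _); rewrite /= ?scaler0 ?add0r.
by move=> dF; split; rewrite /derivable /dx1 /pd /derive E.
Qed.

Lemma is_derive_dx2 F x y t :
  derivable F (x, y, t) (dir R (@Ordinal 3 1 isT)) ->
  is_derive y (1 : R) (fun z => F (x, z, t)) (dx2 F (x, y, t)).
Proof.
have E : (fun h : R => h^-1 *:
      (((fun z => F (x, z, t)) \o shift y) (h *: (1 : R)) - F (x, y, t))) =
    (fun h => h^-1 *: ((F \o shift (x, y, t)) (h *: dir R (@Ordinal 3 1 isT))
      - F (x, y, t))).
  apply/funext => h; congr (_ *: (_ - _)); rewrite /= /dir/=; congr F.
  by congr (_, _, _); rewrite /= ?scaler0 ?add0r.
by move=> dF; split; rewrite /derivable /dx2 /pd /derive E.
Qed.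

Lemma is_derive_dt F (p : R * R) t :
  derivable F (p, t) (dir R (@Ordinal 3 2 isT)) ->
  is_derive t (1 : R) (fun z => F (p, z)) (dt F (p, t)).
Proof.
case: p => x y.
have E : (fun h : R => h^-1 *:
      (((fun z => F (x, y, z)) \o shift t) (h *: (1 : R)) - F (x, y, t))) =
    (fun h => h^-1 *: ((F \o shift (x, y, t)) (h *: dir R (@Ordinal 3 2 isT))
      - F (x, y, t))).
  apply/funext => h; congr (_ *: (_ - _)); rewrite /= /dir/=; congr F.
  by congr (_, _, _); rewrite /= ?scaler0 ?add0r.
by move=> dF; split; rewrite /derivable /dt /pd /derive E.
Qed.

End PartialDerivatives.

(** * Derivatives of periodic functions have zero mean *)

Section PeriodicDivergence.
Variable R : realType.
Notation mu1 := (@lebesgue_measure R).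
Notation mu2 := (@leb2 R).
Variables (G g : R * R -> R).
Hypothesis cg : continuous g.

Let c01 : @measurable _ (measurableTypeR R) `[0, 1[%classic.
Proof. exact: measurable_itv. Qed.

Let periodic_integral (h h' : R -> R) : continuous h' ->
  (forall x : R, is_derive x (1 : R) h (h' x)) -> h 1 = h 0 ->
  (\int[mu1]_(x in `[0%R, 1%R[) (h' x)%:E = 0)%E.
Proof.
move=> ch dh h10.
rewrite integral_itv_bndo_bndc.
  by rewrite (FTC2_lt dh ch ltr01) h10 subrr.
apply/measurable_EFinP; apply: measurable_funTS.
exact: continuous_measurable_fun.
Qed.

(** The order of integration is chosen so that the differentiated variable is innermost; its
    integral is the boundary difference [G (1, y) - G (0, y)]. *)
Lemma periodic_dx1_integral :
  (forall x y : R, is_derive x (1 : R) (fun z => G (z, y)) (g (x, y))) ->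
  (forall y, G (1, y) = G (0, y)) -> \int[mu2]_(x in @T2dom R) g x = 0.
Proof.
move=> dG G10; rewrite /Rintegral T2domE.
rewrite (@rectangle_integral2 R `[0, 1[%classic `[0, 1[%classic)//.
rewrite integral0_eq// => y _.
exact: (periodic_integral (continuous_slice1 cg) (fun x => dG x y)).
Qed.

Lemma periodic_dx2_integral :
  (forall x y : R, is_derive y (1 : R) (fun z => G (x, z)) (g (x, y))) ->
  (forall x, G (x, 1) = G (x, 0)) -> \int[mu2]_(x in @T2dom R) g x = 0.
Proof.
move=> dG G10; rewrite /Rintegral T2domE.
rewrite (@rectangle_integral1 R `[0, 1[%classic `[0, 1[%classic)//.
rewrite integral0_eq// => x _.
exact: (periodic_integral (continuous_slice2 cg) (fun y => dG x y)).
Qed.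

End PeriodicDivergence.

Section RealDerivatives.
Variables (R : realType) (f g : R -> R) (x df dg : R).
Hypotheses (Df : is_derive x (1 : R) f df) (Dg : is_derive x (1 : R) g dg).

Lemma is_derive_mul : is_derive x (1 : R) (fun z => f z * g z) (df * g x + f x * dg).
Proof.
have D := @is_deriveM _ _ f g x 1 _ _ Df Dg.
by apply: is_derive_eq D _; rewrite addrC mulrC.
Qed.

Lemma is_derive_sub : is_derive x (1 : R) (fun z => f z - g z) (df - dg).
Proof. exact: (@is_deriveB _ _ _ f g x 1 _ _ Df Dg). Qed.

Lemma is_derive_scale k : is_derive x (1 : R) (fun z => k * f z) (k * df).
Proof. exact: (@is_deriveZ _ _ _ f k x 1 _ Df). Qed.

Lemma is_derive_sqr : is_derive x (1 : R) (fun z => f z ^+ 2) (2 * f x * df).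
Proof.
have D := @is_deriveM _ _ f f x 1 _ _ Df Df.
apply: is_derive_eq D _; rewrite /GRing.scale/=; ring.
Qed.

End RealDerivatives.

Section Periodicity.
Variables (R : realType) (F : R * R * R -> R).
Hypothesis pF : periodic_st F.

(** The difference quotients agree for every [h], so their limits agree without any
    differentiability. *)
Lemma dx1_periodic1 x y t : dx1 F (x + 1, y, t) = dx1 F (x, y, t).
Proof.
rewrite /dx1 /pd /derive; apply: (congr1 (fun f : R -> R => lim (f @ 0^'))).
apply/funext => h.
rewrite (pF x y t).1; congr (_ *: (_ - _)); rewrite /= /dir/=.
transitivity (F (h * 1 + x + 1, h * 0 + y, h * 0 + t)).
  by congr F; congr (_, _, _); rewrite /= addrA.
exact: (pF (h * 1 + x) (h * 0 + y) (h * 0 + t)).1.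
Qed.

Lemma dx2_periodic2 x y t : dx2 F (x, y + 1, t) = dx2 F (x, y, t).
Proof.
rewrite /dx2 /pd /derive; apply: (congr1 (fun f : R -> R => lim (f @ 0^'))).
apply/funext => h.
rewrite (pF x y t).2; congr (_ *: (_ - _)); rewrite /= /dir/=.
transitivity (F (h * 0 + x, h * 1 + y + 1, h * 0 + t)).
  by congr F; congr (_, _, _); rewrite /= addrA.
exact: (pF (h * 0 + x) (h * 1 + y) (h * 0 + t)).2.
Qed.

End Periodicity.

Lemma continuous_time_slice (R : realType) (F : R * R * R -> R) t :
  (forall p, 0 < p.2 -> {for p, continuous F}) -> 0 < t ->
  continuous (fun x : R * R => F (x, t)).
Proof.
move=> cF t0 x; apply: (@continuous_comp _ _ _ (fun x => (x, t)) F); last exact: cF.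
by apply: (@cvg_pair _ _ _ _ (nbhs x) (nbhs t)); [exact: cvg_id|exact: cvg_cst].
Qed.

(** Provides the constant that dominates the time derivative in [enstrophy_derive]; [0 < a] keeps
    the compact slab inside positive times. *)
Lemma continuous_bounded_slab (R : realType) (F : R * R * R -> R) a b :
  (forall p, 0 < p.2 -> {for p, continuous F}) -> 0 < a ->
  exists2 M, 0 < M & forall x t, T2dom x -> a <= t <= b -> `|F (x, t)| <= M.
Proof.
move=> cF a0.
have : compact (F @` (`[0, 1]%classic `*` `[0, 1]%classic `*` `[a, b]%classic)).
  apply: continuous_compact.
    apply: continuous_in_subspaceT => p; rewrite inE => -[_ /=].
    by rewrite in_itv/= => /andP[h _]; apply: cF; exact: lt_le_trans h.
  by apply: compact_setX; [apply: compact_setX|]; exact: segment_compact.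
move=> /compact_bounded [M [_ hM]].
exists (`|M| + 1); first by rewrite ltr_wpDl.
move=> x t /andP[/andP[? ?] /andP[? ?]] abt; apply: (hM (`|M| + 1)).
  by rewrite (le_lt_trans (ler_norm _))// ltrDl.
exists (x, t) => //; do !split; rewrite /= in_itv//=; apply/andP; split => //;
  exact: ltW.
Qed.

(** Real-valued, so that it can be differentiated in time; [L2sqE] identifies it with [L2sq] at
    positive times. *)
Definition enstrophy (R : realType) (w : R * R * R -> R) (t : R) : R :=
  \int[@leb2 R]_(x in @T2dom R) (w (x, t) ^+ 2).

Definition palinstrophy (R : realType) (w : R * R * R -> R) (t : R) : R :=
  \int[@leb2 R]_(x in @T2dom R) (dx1 w (x, t) ^+ 2 + dx2 w (x, t) ^+ 2).

(** * Enstrophy balance and decay *)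

Section Energy.
Variables (R : realType) (nu : R) (w u1 u2 : R * R * R -> R).
Notation mu2 := (@leb2 R).
Hypotheses (sw : smooth_on (@pos_time R) w) (su1 : smooth_on (@pos_time R) u1)
  (su2 : smooth_on (@pos_time R) u2).
Hypotheses (pw : periodic_st w) (pu1 : periodic_st u1) (pu2 : periodic_st u2).
Hypothesis vorticity_eq : forall p, 0 < p.2 ->
  dt w p + u1 p * dx1 w p + u2 p * dx2 w p =
  nu * (dx1 (dx1 w) p + dx2 (dx2 w) p).
Hypothesis divergence_free : forall p, 0 < p.2 -> dx1 u1 p + dx2 u2 p = 0.

Let o0 : 'I_3 := @Ordinal 3 0 isT.
Let o1 : 'I_3 := @Ordinal 3 1 isT.
Let o2 : 'I_3 := @Ordinal 3 2 isT.

Let cont F s t : smooth_on (@pos_time R) F -> 0 < t ->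
  continuous (fun x : R * R => ipd s F (x, t)).
Proof. by move=> sF t0; apply: continuous_time_slice => // p p0; case: (sF s p p0). Qed.

Lemma enstrophy_flux (t : R) : 0 < t ->
  \int[mu2]_(x in @T2dom R) (2 * w (x, t) * dt w (x, t)) =
  - (2 * nu) * palinstrophy w t.
Proof.
move=> t0.
have cw : continuous (fun x : R * R => w (x, t)) := @cont w [::] t sw t0.
have cu1 : continuous (fun x : R * R => u1 (x, t)) := @cont u1 [::] t su1 t0.
have cu2 : continuous (fun x : R * R => u2 (x, t)) := @cont u2 [::] t su2 t0.
have cw1 : continuous (fun x : R * R => dx1 w (x, t)) := @cont w [:: o0] t sw t0.
have cw2 : continuous (fun x : R * R => dx2 w (x, t)) := @cont w [:: o1] t sw t0.
have cwt : continuous (fun x : R * R => dt w (x, t)) := @cont w [:: o2] t sw t0.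
have cw11 : continuous (fun x : R * R => dx1 (dx1 w) (x, t)) := @cont w [:: o0; o0] t sw t0.
have cw22 : continuous (fun x : R * R => dx2 (dx2 w) (x, t)) := @cont w [:: o1; o1] t sw t0.
have cu11 : continuous (fun x : R * R => dx1 u1 (x, t)) := @cont u1 [:: o0] t su1 t0.
have cu22 : continuous (fun x : R * R => dx2 u2 (x, t)) := @cont u2 [:: o1] t su2 t0.
have dw1 (x y : R) : is_derive x (1 : R) (fun z => w (z, y, t)) (dx1 w (x, y, t)).
  exact (@is_derive_dx1 R w x y t ((sw [::] (p := (x, y, t)) t0).2 o0)).
have dw11 (x y : R) : is_derive x (1 : R) (fun z => dx1 w (z, y, t)) (dx1 (dx1 w) (x, y, t)).
  exact (@is_derive_dx1 R (dx1 w) x y t ((sw [:: o0] (p := (x, y, t)) t0).2 o0)).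
have du11 (x y : R) : is_derive x (1 : R) (fun z => u1 (z, y, t)) (dx1 u1 (x, y, t)).
  exact (@is_derive_dx1 R u1 x y t ((su1 [::] (p := (x, y, t)) t0).2 o0)).
have dw2 (x y : R) : is_derive y (1 : R) (fun z => w (x, z, t)) (dx2 w (x, y, t)).
  exact (@is_derive_dx2 R w x y t ((sw [::] (p := (x, y, t)) t0).2 o1)).
have dw22 (x y : R) : is_derive y (1 : R) (fun z => dx2 w (x, z, t)) (dx2 (dx2 w) (x, y, t)).
  exact (@is_derive_dx2 R (dx2 w) x y t ((sw [:: o1] (p := (x, y, t)) t0).2 o1)).
have du22 (x y : R) : is_derive y (1 : R) (fun z => u2 (x, z, t)) (dx2 u2 (x, y, t)).
  exact (@is_derive_dx2 R u2 x y t ((su2 [::] (p := (x, y, t)) t0).2 o1)).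
(* [g1 + g2 = div (2 nu w grad w - u w^2)] is [2 w w_t + 2 nu |grad w|^2] by
   the equation and incompressibility, and has zero mean by periodicity. *)
pose G1 (p : R * R) := 2 * nu * (w (p, t) * dx1 w (p, t)) - u1 (p, t) * w (p, t) ^+ 2.
pose G2 (p : R * R) := 2 * nu * (w (p, t) * dx2 w (p, t)) - u2 (p, t) * w (p, t) ^+ 2.
pose g1 (p : R * R) :=
  2 * nu * (dx1 w (p, t) * dx1 w (p, t) + w (p, t) * dx1 (dx1 w) (p, t)) -
  (dx1 u1 (p, t) * w (p, t) ^+ 2 + u1 (p, t) * (2 * w (p, t) * dx1 w (p, t))).
pose g2 (p : R * R) :=
  2 * nu * (dx2 w (p, t) * dx2 w (p, t) + w (p, t) * dx2 (dx2 w) (p, t)) -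
  (dx2 u2 (p, t) * w (p, t) ^+ 2 + u2 (p, t) * (2 * w (p, t) * dx2 w (p, t))).
have cM (h k : R * R -> R) : continuous h -> continuous k ->
    continuous (fun p => h p * k p).
  by move=> ch ck p; apply: cvgM; [exact: ch|exact: ck].
have cD (h k : R * R -> R) : continuous h -> continuous k ->
    continuous (fun p => h p + k p).
  by move=> ch ck p; apply: cvgD; [exact: ch|exact: ck].
have cB (h k : R * R -> R) : continuous h -> continuous k ->
    continuous (fun p => h p - k p).
  by move=> ch ck p; apply: cvgB; [exact: ch|exact: ck].
have cZ (c : R) (h : R * R -> R) : continuous h -> continuous (fun p => c * h p).
  by move=> ch p; apply: cvgMr; exact: ch.
have cS (h : R * R -> R) : continuous h -> continuous (fun p => h p ^+ 2).
  by move=> ch; exact: (cM h h).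
have cg1 : continuous g1 := cB _ _
  (cZ (2 * nu) _ (cD _ _ (cM _ _ cw1 cw1) (cM _ _ cw cw11)))
  (cD _ _ (cM _ _ cu11 (cS _ cw)) (cM _ _ cu1 (cM _ _ (cZ 2 _ cw) cw1))).
have cg2 : continuous g2 := cB _ _
  (cZ (2 * nu) _ (cD _ _ (cM _ _ cw2 cw2) (cM _ _ cw cw22)))
  (cD _ _ (cM _ _ cu22 (cS _ cw)) (cM _ _ cu2 (cM _ _ (cZ 2 _ cw) cw2))).
have I1 : \int[mu2]_(x in @T2dom R) g1 x = 0.
  apply: (periodic_dx1_integral (G := G1) cg1).
    move=> x y; exact: (is_derive_sub
      (is_derive_scale (is_derive_mul (dw1 x y) (dw11 x y)) (2 * nu))
      (is_derive_mul (du11 x y) (is_derive_sqr (dw1 x y)))).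
  move=> y; rewrite /G1 -[1]add0r.
  by rewrite (pw _ _ _).1 (pu1 _ _ _).1 dx1_periodic1.
have I2 : \int[mu2]_(x in @T2dom R) g2 x = 0.
  apply: (periodic_dx2_integral (G := G2) cg2).
    move=> x y; exact: (is_derive_sub
      (is_derive_scale (is_derive_mul (dw2 x y) (dw22 x y)) (2 * nu))
      (is_derive_mul (du22 x y) (is_derive_sqr (dw2 x y)))).
  move=> x; rewrite /G2 -[1]add0r.
  by rewrite (pw _ _ _).2 (pu2 _ _ _).2 dx2_periodic2.
have int (h : R * R -> R) : continuous h -> mu2.-integrable (@T2dom R) (EFin \o h).
  by move=> ch; apply: continuous_plane_integrable => //; exact: measurable_T2dom.
have mT := @measurable_T2dom R.
have cww : continuous (fun p : R * R => 2 * w (p, t) * dt w (p, t)).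
  exact: (cM _ _ (cZ 2 _ cw) cwt).
have cdd : continuous (fun p : R * R => dx1 w (p, t) ^+ 2 + dx2 w (p, t) ^+ 2).
  exact: (cD _ _ (cS _ cw1) (cS _ cw2)).
have cdd' := cZ (2 * nu) _ cdd.
have : \int[mu2]_(x in @T2dom R) (2 * w (x, t) * dt w (x, t) +
    2 * nu * (dx1 w (x, t) ^+ 2 + dx2 w (x, t) ^+ 2)) =
    \int[mu2]_(x in @T2dom R) (g1 x + g2 x).
  apply: eq_Rintegral => x _; rewrite /g1 /g2.
  move: (@vorticity_eq (x, t) t0) (@divergence_free (x, t) t0).
  move: (dx1 (dx1 w) (x, t)) (dx2 (dx2 w) (x, t)) (dx1 u1 (x, t)) (dx2 u2 (x, t)).
  move: (dx1 w (x, t)) (dx2 w (x, t)) (dt w (x, t)) (w (x, t)).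
  move: (u1 (x, t)) (u2 (x, t)) => U1 U2 W1 W2 Wt W W11 W22 D11 D22.
  (* The equation is solved for the time derivative and incompressibility for [D11]; what remains is
     a polynomial identity. *)
  move=> /(canRL (addrK _)) /(canRL (addrK _)) -> /(canRL (addrK _)) ->.
  ring.
move=> E; have E1 := RintegralD mT (int _ cww) (int _ cdd').
have E2 := RintegralD mT (int _ cg1) (int _ cg2).
have E3 := RintegralZl (2 * nu) mT (int _ cdd).
have E4 := etrans (etrans (congr1 (fun z => _ + z) (esym E3)) (esym E1))
  (etrans E (etrans E2 (congr2 +%R I1 I2))).
by move/(canRL (addrK _)): E4 => ->; rewrite addr0 add0r mulNr.
Qed.

Lemma enstrophy_derive (t : R) : 0 < t ->
  is_derive t (1 : R) (enstrophy w) (- (2 * nu) * palinstrophy w t).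
Proof.
move=> t0.
have cw p : 0 < p.2 -> {for p, continuous w} by move=> p0; case: (sw [::] p0).
have cwt p : 0 < p.2 -> {for p, continuous (dt w)}.
  by move=> p0; case: (sw [:: o2] p0).
have cF p : 0 < p.2 -> {for p, continuous (fun q => 2 * w q * dt w q)}.
  move=> p0; apply: cvgM; last exact: cwt.
  by apply: cvgMr; exact: cw.
have t2 : 0 < t / 2 by rewrite divr_gt0.
(* A constant bound for [2 w w_t] on a time interval around [t] permits differentiation under the
   integral. *)
have [M M0 hM] := continuous_bounded_slab (t + 1) cF t2.
have dsq (x : R * R) (s : R) : 0 < s ->
    is_derive s (1 : R) (fun z => w (x, z) ^+ 2) (2 * w (x, s) * dt w (x, s)).
  move=> s0; apply: is_derive_sqr; apply: is_derive_dt.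
  by case: (sw [::] (p := (x, s)) s0).
have It : `]t / 2, t + 1[%classic t by rewrite /= in_itv/=; apply/andP; split; lra.
have pos (s : R) : `]t / 2, t + 1[%classic s -> 0 < s.
  by rewrite /= in_itv/= => /andP[h _]; exact: lt_trans h.
have csq (s : R) : 0 < s -> continuous (fun x : R * R => w (x, s) ^+ 2).
  move=> s0 x; apply: cvgM; exact: (continuous_time_slice cw s0).
have int (s : R) : `]t / 2, t + 1[%classic s ->
    mu2.-integrable (@T2dom R) (EFin \o (fun x => w (x, s) ^+ 2)).
  move=> /pos s0; apply: continuous_plane_integrable => //.
    exact: measurable_T2dom.
  exact: csq.
have dd (s : R) (y : R * R) : `]t / 2, t + 1[%classic s -> T2dom y ->
    derivable (fun z => w (y, z) ^+ 2) s (1 : R).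
  by move=> /pos s0 _; case: (dsq y s s0).
have iM : mu2.-integrable (@T2dom R) (EFin \o (fun=> M)).
  apply: continuous_plane_integrable => //; first exact: measurable_T2dom.
  by move=> x; exact: cvg_cst.
have bM (s : R) (y : R * R) : `]t / 2, t + 1[%classic s -> T2dom y ->
    `|partial1of2 (fun s (y : R * R) => w (y, s) ^+ 2) s y| <= M.
  move=> ts Ty; rewrite partial1of2E.
  case: (dsq y s (pos _ ts)) => _ ->; apply: hM => //.
  by move: ts; rewrite /= in_itv/= => /andP[h1 h2]; rewrite !ltW.
have H1 := @derivable_under_integral R _ _ mu2
  (fun s (y : R * R) => w (y, s) ^+ 2) _ (@measurable_T2dom R) _ _ _ It int dd
  (fun=> M) (fun=> ltW M0) iM bM.
have H2 := @differentiation_under_integral R _ _ mu2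
  (fun s (y : R * R) => w (y, s) ^+ 2) _ (@measurable_T2dom R) _ _ _ It int dd
  (fun=> M) (fun=> ltW M0) iM bM.
split; first exact: H1.
rewrite -derive1E H2 -(enstrophy_flux t0); apply: eq_Rintegral => x _.
by rewrite partial1of2E; case: (dsq x t t0).
Qed.

(* Comparing [(tau - s)^2 y(tau)] with a linear function of [tau] makes the
   bound at [t] independent of the value of the enstrophy [y] at time [s]. *)
Lemma enstrophy_decay (t B K : R) : 0 < nu -> 0 < t -> nu * t < 1 ->
  (forall (x : R * R) (tau : R), 0 < tau ->
    (\int[mu2]_(y in tball x (Num.sqrt (nu * t) / 2)%R) (`|w (y, tau)|)%:E
      <= B%:E)%E) ->
  (forall tau : R, 0 < tau -> \int[mu2]_(x in @T2dom R) `|w (x, tau)| <= K) ->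
  enstrophy w t <= 256 * B * K / (nu * t).
Proof.
move=> nu0 t0 nut1 hB hK.
have B0 : 0 <= B.
  by rewrite -lee_fin; apply: le_trans (hB (0, 0) _ t0); apply: integral_ge0.
have K0 : 0 <= K.
  by apply: le_trans (hK _ t0); apply: Rintegral_ge0.
pose s := t / 2; have s0 : 0 < s by rewrite divr_gt0.
have st : s < t by rewrite /s; lra.
(* This is [2 sg] times [8 / r^2] times [B K] with [r^2 = nu sg / 8], where [sg = tau - s]
   cancels. *)
pose c := 128 * B * K / nu.
have key (tau : R) : s < tau < t ->
    2 * (tau - s) * enstrophy w tau - 2 * nu * (tau - s) ^+ 2 * palinstrophy w tau <= c.
  move=> /andP[stau taut]; have tau0 : 0 < tau by exact: lt_trans stau.
  pose sg := tau - s; have sg0 : 0 < sg by rewrite subr_gt0.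
  have sgt : sg < t / 2 by rewrite /sg /s; lra.
  (* The divisor 8 makes [2 r <= sqrt(nu t) / 2], because [4 r^2 = nu sg / 2] and [sg < t / 2]. *)
  pose r := Num.sqrt (nu * sg / 8).
  have q0 : 0 < nu * sg / 8 by rewrite divr_gt0// mulr_gt0.
  have r0 : 0 < r by rewrite sqrtr_gt0.
  have r2 : r ^+ 2 = nu * sg / 8 by rewrite sqr_sqrtr// ltW.
  have nusg : nu * sg <= nu * t / 2.
    by rewrite -mulrA ler_pM2l// ltW.
  have r1 : r <= 1.
    by rewrite -(ler_pXn2r (ltn0Sn 1)) ?nnegrE ?(ltW r0)// expr1n r2; lra.
  (* The grid has side [1 / (m + 1)], which lies between [r / 2] and [r]; the lower bound uses
     [r <= 1]. *)
  pose m := Num.truncn r^-1.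
  have rm : m%:R <= r^-1 < m.+1%:R by apply: truncn_itv; rewrite invr_ge0 ltW.
  have m0 : 0 < m.+1%:R :> R by rewrite ltr0n.
  have lr : m.+1%:R^-1 <= r.
    by rewrite -[leRHS]invrK lef_pV2 ?posrE ?invr_gt0// ltW//; case/andP: rm.
  have rl : m.+1%:R <= 2 / r.
    rewrite -natr1; case/andP: rm => rm _.
    have : 1 <= r^-1 by rewrite invf_ge1.
    by move=> h; rewrite mulr_natl mulr2n lerD.
  have lball : 2 * m.+1%:R^-1 <= Num.sqrt (nu * t) / 2.
    apply: (@le_trans _ _ (2 * r)); first by rewrite ler_pM2l.
    rewrite -(ler_pXn2r (ltn0Sn 1)) ?nnegrE ?mulr_ge0 ?sqrtr_ge0 ?invr_ge0 ?(ltW r0)//.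
    have := sqr_sqrtr (ltW (mulr_gt0 nu0 t0)).
    move: (Num.sqrt (nu * t)) => z zE.
    rewrite exprMn r2 expr_div_n zE; lra.
  have cw : continuous (fun x : R * R => w (x, tau)) := @cont w [::] tau sw tau0.
  have cw1 : continuous (fun x : R * R => dx1 w (x, tau)) := @cont w [:: o0] tau sw tau0.
  have cw2 : continuous (fun x : R * R => dx2 w (x, tau)) := @cont w [:: o1] tau sw tau0.
  have D1 (x y : R) : is_derive x (1 : R) (fun z => w (z, y, tau)) (dx1 w (x, y, tau)).
    by apply: is_derive_dx1; case: (sw [::] (p := (x, y, tau)) tau0).
  have D2 (x y : R) : is_derive y (1 : R) (fun z => w (x, z, tau)) (dx2 w (x, y, tau)).
    by apply: is_derive_dx2; case: (sw [::] (p := (x, y, tau)) tau0).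
  have := torus_L2_le cw cw1 cw2 D1 D2 lball (fun x => hB x tau tau0).
  rewrite -/(enstrophy w tau) -/(palinstrophy w tau).
  have dis0 : 0 <= palinstrophy w tau.
    by apply: Rintegral_ge0 => x _; rewrite addr_ge0 ?sqr_ge0.
  set A := \int[mu2]_(x in _) `|_| => hE.
  have AK : A <= K by exact: hK.
  have A0 : 0 <= A by apply: Rintegral_ge0.
  have e1 : 2 / m.+1%:R^-1 ^+ 2 * B * A <= 8 / r ^+ 2 * (B * K).
    rewrite -[leLHS]mulrA; apply: ler_pM.
    - by rewrite divr_ge0// sqr_ge0.
    - exact: mulr_ge0.
    - rewrite exprVn invrK.
      have -> : 8 / r ^+ 2 = 2 * (2 / r) ^+ 2 by field; rewrite gt_eqF.
      by rewrite ler_pM2l// ler_pXn2r// nnegrE ?divr_ge0 ?ltW.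
    - by apply: ler_pM.
  have e2 : m.+1%:R^-1 ^+ 2 * palinstrophy w tau <= r ^+ 2 * palinstrophy w tau.
    apply: ler_wpM2r => //; rewrite ler_pXn2r// nnegrE ?invr_ge0 ltW//.
  have e3 : enstrophy w tau <= 8 / (nu * sg / 8) * (B * K) + nu * sg / 8 * palinstrophy w tau.
    by rewrite -r2; apply: le_trans hE _; exact: lerD.
  (* After multiplication by [2 sg], the gradient term is a quarter of [nu sg^2 D], with [D] the
     palinstrophy, well below the available [2 nu sg^2 D]. *)
  have e4 : 2 * sg * enstrophy w tau <=
      2 * sg * (8 / (nu * sg / 8) * (B * K) + nu * sg / 8 * palinstrophy w tau).
    by rewrite ler_pM2l// mulr_gt0.
  have e5 : 2 * sg * (8 / (nu * sg / 8) * (B * K) + nu * sg / 8 * palinstrophy w tau) =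
      c + nu * sg ^+ 2 * palinstrophy w tau / 4.
    by rewrite /c; field; rewrite !gt_eqF.
  have e6 : 0 <= nu * sg ^+ 2 * palinstrophy w tau.
    by rewrite !mulr_ge0// ltW.
  rewrite -/sg; lra.
pose phi (tau : R) := (tau - s) ^+ 2 * enstrophy w tau - c * tau.
have dphi (tau : R) : 0 < tau -> is_derive tau (1 : R) phi
    (2 * (tau - s) * enstrophy w tau + (tau - s) ^+ 2 * (- (2 * nu) * palinstrophy w tau) - c).
  move=> tau0.
  have d1 : is_derive tau (1 : R) (fun z : R => z - s) (1 - 0).
    exact: is_derive_sub.
  have d2 := is_derive_mul (is_derive_sqr d1) (enstrophy_derive tau0).
  have d3 := is_derive_scale (@is_derive_id _ _ tau (1 : R)) c.
  by apply: is_derive_eq (is_derive_sub d2 d3) _; rewrite subr0 !mulr1.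
have H1 x : x \in `]s, t[ -> derivable phi x 1.
  by rewrite in_itv/= => /andP[sx _]; case: (dphi x (lt_trans s0 sx)).
have H2 x : x \in `]s, t[ -> (phi^`()%classic x <= 0)%R.
  rewrite in_itv/= => sxt; have /andP[sx _] := sxt.
  rewrite derive1E; case: (dphi x (lt_trans s0 sx)) => _ ->.
  move: (key x sxt); move: (enstrophy w x) (palinstrophy w x) => y D h.
  by rewrite subr_le0; apply: le_trans h; rewrite le_eqVlt; apply/orP; left;
    apply/eqP; ring.
have H3 : {within `[s, t], continuous phi}.
  apply: derivable_within_continuous => x; rewrite in_itv/= => /andP[sx _].
  by case: (dphi x (lt_le_trans s0 sx)).
(* The weight vanishes at [s], so [phi t <= phi s] reads [(t / 2)^2 y(t) <= c t / 2]; dividing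
   doubles 128 to 256. *)
have := ler0_derive1_nincr H1 H2 H3 (lexx s) (ltW st) (lexx t).
rewrite /phi subrr expr0n/= mul0r sub0r /c => h.
have ts : t - s = t / 2 by rewrite /s; lra.
rewrite ler_pdivlMr ?mulr_gt0//.
have h1 : (t / 2) ^+ 2 * enstrophy w t <= 128 * B * K / nu * (t / 2).
  by move: h; rewrite ts /s; lra.
have h2 : t / 2 * enstrophy w t <= 128 * B * K / nu.
  have t2 : 0 < t / 2 by rewrite divr_gt0.
  by rewrite -(ler_pM2r t2); move: h1; rewrite expr2; lra.
move: h2; rewrite ler_pdivlMr//; lra.
Qed.

End Energy.

Lemma L2sqE (R : realType) (w : R * R * R -> R) t :
  smooth_on (@pos_time R) w -> 0 < t -> L2sq w t = (enstrophy w t)%:E.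
Proof.
move=> sw t0; rewrite /L2sq -EFin_Rintegral_integrable//.
  exact: measurable_T2dom.
apply: (@continuous_plane_integrable R _ (fun x => w (x, t) ^+ 2)) => //.
  exact: measurable_T2dom.
have cw : continuous (fun x : R * R => w (x, t)).
  by apply: continuous_time_slice => // p p0; case: (sw [::] p p0).
by move=> x; apply: cvgM; exact: cw.
Qed.

Lemma Momega_ball (R : realType) (w : R -> R * R * R -> R) r B nu x t :
  (Momega w r <= B%:E)%E -> 0 < nu -> 0 < t ->
  (\int[@leb2 R]_(y in tball x r) (`|w nu (y, t)|)%:E <= B%:E)%E.
Proof.
move=> h nu0 t0; apply: le_trans h; apply: ereal_sup_ubound.
by exists nu, x, t.
Qed.

Lemma L2sq_le_Momega (R : realType) (w u1 u2 : R -> R * R * R -> R) nu t B k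
    u01 u02 mup mun :
  0 < nu -> 0 < t -> nu * t < 1 ->
  ns_solution nu (w nu) (u1 nu) (u2 nu) u01 u02 mup mun ->
  (Momega w (Num.sqrt (nu * t) / 2) <= B%:E)%E ->
  (Momega w 4^-1 <= k%:E)%E ->
  (L2sq (w nu) t <= (128 ^+ 2 * k * B / (nu * t))%:E)%E.
Proof.
move=> nu0 t0 nut1 [[[pw [pu1 pu2]] [sw [su1 su2]]] eqn dv _ _] hB hk.
rewrite L2sqE// lee_fin.
have -> : 128 ^+ 2 * k * B / (nu * t) = 256 * B * (64 * k) / (nu * t).
  by congr (_ / _); ring.
apply: (enstrophy_decay sw su1 su2 pw pu1 pu2 eqn) => //.
- by move=> p p0; case: (dv p p0).
- by move=> x tau tau0; exact: Momega_ball hB nu0 tau0.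
- move=> tau tau0.
  have -> : 64 * k = 8%:R ^+ 2 * k :> R by ring.
  (* [m = 7] means 64 cells of side [1/8], each inside a ball of radius [1/4]; hence [K = 64 k], and
     [256 * 64 = 128^2]. *)
  apply: (@torus_L1_le R 7 (fun x => w nu (x, tau)) 4^-1).
  + by apply: continuous_time_slice => // p p0; case: (sw [::] p p0).
  + lra.
  + by move=> x; exact: Momega_ball hk nu0 tau0.
Qed.

(** * Integration of the decay bound in time *)

Section TimeIntegral.
Variables (R : realType) (w : R * R * R -> R).
Hypothesis sw : smooth_on (@pos_time R) w.
Hypothesis dE : forall t : R, 0 < t -> derivable (enstrophy w) t 1.
Notation mu1 := (@lebesgue_measure R).

Lemma L2sq_measurable (a b : R) : 0 < a -> measurable_fun `[a, b]%classic (L2sq w).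
Proof.
move=> a0; apply: (eq_measurable_fun (EFin \o enstrophy w)).
  move=> t; rewrite inE /= in_itv/= => /andP[at_ _].
  by rewrite L2sqE//; exact: lt_le_trans at_.
apply/measurable_EFinP; apply: subspace_continuous_measurable_fun => //.
apply: derivable_within_continuous => t; rewrite in_itv/= => /andP[at_ _].
by apply: dE; exact: lt_le_trans at_.
Qed.

Lemma integral_L2sq_le (F f : R -> R) (a b : R) : 0 < a -> a < b ->
  (forall t : R, 0 < t -> is_derive t (1 : R) F (f t)) ->
  (forall t : R, 0 < t -> {for t, continuous f}) ->
  (forall t : R, a <= t <= b -> (L2sq w t <= (f t)%:E)%E) ->
  (\int[mu1]_(t in `[a, b]) L2sq w t <= (F b - F a)%:E)%E.
Proof.
move=> a0 ab dF cf hf.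
have wcf : {within `[a, b], continuous f}.
  apply: continuous_in_subspaceT => t; rewrite inE /= in_itv/= => /andP[h _].
  by apply: cf; exact: lt_le_trans h.
have cF (t : R) : 0 < t -> {for t, continuous F}.
  move=> t0; apply: differentiable_continuous; apply/derivable1_diffP.
  by case: (dF t t0).
have FTC : (\int[mu1]_(t in `[a, b]) (f t)%:E = (F b - F a)%:E)%E.
  rewrite EFinB; apply: (@continuous_FTC2 R f F a b ab wcf).
  - split.
    + move=> t; rewrite in_itv/= => /andP[h _].
      by case: (dF t (lt_trans a0 h)).
    + by apply: cvg_at_right_filter; exact: cF.
    + by apply: cvg_at_left_filter; apply: cF; exact: lt_trans ab.
  - move=> t; rewrite in_itv/= => /andP[h _].
    by rewrite derive1E; case: (dF t (lt_trans a0 h)).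
rewrite -FTC; apply: ge0_le_integral => //.
- by move=> t _; apply: integral_ge0 => x _; rewrite lee_fin sqr_ge0.
- exact: L2sq_measurable.
- by apply/measurable_EFinP; apply: subspace_continuous_measurable_fun.
Qed.

(** Monotone convergence along shrinking left endpoints reaches time 0, where neither the enstrophy
    nor its majorant needs to stay bounded. *)
Lemma integral_L2sq_le0 (M T : R) : 0 < T ->
  (forall a : R, 0 < a -> a < T -> (\int[mu1]_(t in `[a, T]) L2sq w t <= M%:E)%E) ->
  (\int[mu1]_(t in `]0%R, T]) L2sq w t <= M%:E)%E.
Proof.
move=> T0 hM.
(* The denominator starts at 2, so that already the first left endpoint is strictly below [T]. *)
pose A (n : nat) : set R := `[T / n.+2%:R, T]%classic.
have An n : 0 < T / n.+2%:R by rewrite divr_gt0.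
have -> : `]0%R, T]%classic = \bigcup_n A n :> set R.
  apply/seteqP; split => [t|t [n _]]; rewrite /A /= !in_itv/=; last first.
    by move=> /andP[h ->]; rewrite andbT (lt_le_trans (An n) h).
  move=> /andP[t0 tT]; exists (Num.truncn (T / t)) => //=.
  rewrite in_itv/= tT andbT ler_pdivrMr ?ltr0n// mulrC -ler_pdivrMr//.
  by rewrite (le_trans (ltW (truncnS_gt _)))// ler_nat.
have cv : (\int[mu1]_(t in A n) L2sq w t)%E @[n --> \oo] -->
    (\int[mu1]_(t in \bigcup_n A n) L2sq w t)%E.
  apply: ge0_nondecreasing_set_cvg_integral.
  - apply/nondecreasing_seqP => n; apply/subsetPset => t; rewrite /A /= !in_itv/=.
    move=> /andP[h ->]; rewrite andbT (le_trans _ h)// ler_pM2l//.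
    by rewrite lef_pV2 ?posrE ?ltr0n// ler_nat.
  - by move=> n; exact: measurable_itv.
  - by move=> n; exact: L2sq_measurable.
  - by move=> n t _; apply: integral_ge0 => x _; rewrite lee_fin sqr_ge0.
rewrite -(cvg_lim _ cv)//; apply: lime_le; first by apply/cvg_ex; eexists; exact: cv.
apply: nearW => n; apply: hM => //.
by rewrite ltr_pdivrMr ?ltr0n// ltr_pMr// ltr1n.
Qed.

End TimeIntegral.

(** * Power and logarithm estimates at the radius [sqrt x / 2] *)

Section RealEstimates.
Variable R : realType.

Lemma powR_div_powR (x q : R) : 0 < x -> x `^ (1 - q) / x = (x `^ q)^-1.
Proof.
move=> x0; rewrite powRD; last by rewrite (gt_eqF x0) implybT.
by rewrite powRr1 ?ltW// powRN mulrAC divff ?mul1r// gt_eqF.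
Qed.

Lemma half_sqrt_powR (alpha x : R) : 0 <= alpha -> 0 < x ->
  (Num.sqrt x / 2) `^ alpha <= x `^ (alpha / 2).
Proof.
move=> a0 x0; apply: (@le_trans _ _ (Num.sqrt x `^ alpha)).
  have s0 := sqrtr_ge0 x.
  have s2 : Num.sqrt x / 2 <= Num.sqrt x by lra.
  by apply: ge0_ler_powR => //; rewrite ?nnegrE ?divr_ge0.
by rewrite -powR12_sqrt ?(ltW x0)// -powRrM mulrC.
Qed.

(** [|ln (sqrt x / 2)| = |ln x| / 2 + ln 2], which is at least [|ln x| / 4]; this costs the factor 2
    after the inverse square root. *)
Lemma ln_half_sqrt (x : R) : 0 < x < 1 ->
  `|ln (Num.sqrt x / 2)| `^ (- 2^-1) <= 2 / Num.sqrt `|ln x|.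
Proof.
move=> /andP[x0 x1].
have s0 : 0 < Num.sqrt x by rewrite sqrtr_gt0.
have lx : ln x = 2 * ln (Num.sqrt x).
  by rewrite -{1}(sqr_sqrtr (ltW x0)) expr2 lnM ?posrE//; lra.
have lx0 : ln x < 0 by rewrite ln_lt0// x0.
have lr : ln (Num.sqrt x / 2) = ln x / 2 - ln 2.
  by rewrite ln_div ?posrE//; lra.
have l2 : 0 < ln (2 : R) by rewrite ln_gt0// ltr1n.
rewrite powRN powR12_sqrt// lr ltr0_norm//; last lra.
rewrite [X in _ / Num.sqrt X]ltr0_norm//.
rewrite -[leLHS]mul1r ler_pdivrMr ?sqrtr_gt0; last lra.
rewrite mulrAC ler_pdivlMr ?sqrtr_gt0; last lra.
rewrite mul1r -(ler_pXn2r (ltn0Sn 1)) ?nnegrE ?mulr_ge0 ?sqrtr_ge0//.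
rewrite exprMn !sqr_sqrtr; lra.
Qed.

End RealEstimates.

(** * Insertion of the power and logarithmic moduli *)

Theorem theorem1p1 (R : realType)
    (u01 u02 : R -> R * R -> R)
    (mup mun : R -> {finite_measure set (R * R)%type -> \bar R})
    (w u1 u2 : R -> R * R * R -> R) :
  (* initial data u0^nu, with omega0^nu = curl u0^nu = mup nu - mun nu *)
  (forall nu, 0 < nu -> initial_data (u01 nu) (u02 nu) (mup nu) (mun nu)) ->
  (* sup_nu ||omega0^nu||_M < oo *)
  (exists K : R, forall nu, 0 < nu ->
     (mup nu (@T2dom R) + mun nu (@T2dom R) <= K%:E)%E) ->
  (* omega^nu is the solution with data omega0^nu, u^nu its velocity *)
  (forall nu, 0 < nu ->
     ns_solution nu (w nu) (u1 nu) (u2 nu) (u01 nu) (u02 nu) (mup nu) (mun nu)) ->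
  (* (a) *)
  (forall (alpha C : R), 0 < alpha < 2 -> 0 < C ->
     (forall r, 0 < r -> (Momega w r <= (C * r `^ alpha)%:E)%E) ->
     exists C' : R, 0 < C' /\
       forall nu t T, 0 < nu -> 0 < t -> 0 < T -> nu * t < 1 -> nu * T < 1 ->
         (L2sq (w nu) t <= (C' / (nu * t) `^ ((2 - alpha) / 2))%:E)%E /\
         (nu%:E * \int[lebesgue_measure]_(tau in [set tau : R | (0 < tau <= T)%R]) L2sq (w nu) tau
            <= (C' * (nu * T) `^ (alpha / 2))%:E)%E)
  /\
  (* (b) *)
  (forall C : R, 0 < C ->
     (forall r, 0 < r < 2^-1 ->
        (Momega w r <= (C * `|ln r| `^ (- 2^-1))%:E)%E) ->
     (exists C' : R, 0 < C' /\
       forall nu t, 0 < nu -> 0 < t -> nu * t < 1 ->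
         (L2sq (w nu) t <= (C' / (nu * t * Num.sqrt `|ln (nu * t)|))%:E)%E) /\
     (exists C'' : R, 0 < C'' /\
       forall delta nu T, 0 < delta -> 0 < nu -> delta < T -> nu * T < 1 ->
         (nu%:E * \int[lebesgue_measure]_(tau in [set tau : R | (delta <= tau <= T)%R]) L2sq (w nu) tau
            <= (C'' * ln (T / delta) / Num.sqrt `|ln (nu * T)|)%:E)%E)).

Proof.
move=> _ _ sol.
have smooth nu : 0 < nu -> smooth_on (@pos_time R) (w nu).
  by move=> nu0; case: (sol nu nu0) => [[_ []]].
have dE nu : 0 < nu -> forall t : R, 0 < t -> derivable (enstrophy (w nu)) t 1.
  move=> nu0 t t0; have [[[pw [pu1 pu2]] [sw [su1 su2]]] eqn dv _ _] := sol nu nu0.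
  have dv' p : 0 < p.2 -> dx1 (u1 nu) p + dx2 (u2 nu) p = 0.
    by move=> p0; case: (dv p p0).
  by case: (enstrophy_derive sw su1 su2 pw pu1 pu2 eqn dv' t0).
split.
- move=> alpha C /andP[a0 a2] C0 hM.
  pose q := (2 - alpha) / 2.
  have a2q : alpha / 2 = 1 - q by rewrite /q; field.
  pose k := C * 4^-1 `^ alpha.
  have k0 : 0 < k by rewrite mulr_gt0// powR_gt0.
  pose c := 128 ^+ 2 * k * C.
  have c0 : 0 < c.
    by apply: mulr_gt0; [apply: mulr_gt0; [rewrite exprn_gt0 ?ltr0n|]|].
  have bound nu t : 0 < nu -> 0 < t -> nu * t < 1 ->
      (L2sq (w nu) t <= (c / (nu * t) `^ q)%:E)%E.
    move=> nu0 t0 nut1; have x0 : 0 < nu * t by rewrite mulr_gt0.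
    have hB : (Momega w (Num.sqrt (nu * t) / 2) <=
        (C * (nu * t) `^ (alpha / 2))%:E)%E.
      apply: (le_trans (hM _ _)); first by rewrite divr_gt0// sqrtr_gt0.
      by rewrite lee_fin ler_pM2l// half_sqrt_powR// ltW.
    have hk : (Momega w 4^-1 <= k%:E)%E by apply: hM; rewrite invr_gt0.
    apply: le_trans (L2sq_le_Momega nu0 t0 nut1 (sol nu nu0) hB hk) _.
    rewrite lee_fin a2q -powR_div_powR// /c le_eqVlt; apply/orP; left.
    by apply/eqP; ring.
  have q1 : 0 < alpha / 2 by rewrite divr_gt0.
  pose c' := c * (2 / alpha).
  have c'0 : 0 < c' by rewrite mulr_gt0// divr_gt0.
  (* One constant must serve both estimates: [c] for the pointwise one, and [c'] with the factor
     [2 / alpha] from integrating [t^(alpha / 2 - 1)]. *)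
  exists (c + c'); split; first by rewrite addr_gt0.
  move=> nu t T nu0 t0 T0 nut1 nuT1; split.
    apply: le_trans (bound nu t nu0 t0 nut1) _.
    rewrite lee_fin ler_pM2r ?invr_gt0 ?powR_gt0 ?mulr_gt0//.
    by rewrite lerDl ltW.
  pose d := c / nu `^ q.
  have d0 : 0 < d by rewrite divr_gt0// powR_gt0.
  pose F t : R := d * (2 / alpha) * t `^ (alpha / 2).
  pose f t : R := d * t `^ (alpha / 2 - 1).
  have dF (s : R) : 0 < s -> is_derive s (1 : R) F (f s).
    move=> s0; apply: is_derive_eq (is_derive_scale (is_derive1_powR _ s0) _) _.
    by rewrite /f mulrA; congr (_ * _); field; rewrite gt_eqF.
  have cf (s : R) : 0 < s -> {for s, continuous f}.
    move=> s0; apply: differentiable_continuous; apply/derivable1_diffP.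
    by case: (is_derive_scale (is_derive1_powR (alpha / 2 - 1) s0) d).
  have hI : (\int[lebesgue_measure]_(tau in `]0%R, T]) L2sq (w nu) tau
      <= (F T)%:E)%E.
    apply: integral_L2sq_le0 => //; [exact: smooth|exact: dE|].
    move=> a aa0 aT; apply: (@le_trans _ _ (F T - F a)%:E).
      apply: (@integral_L2sq_le R (w nu) (smooth nu nu0) (dE nu nu0) F f) => //.
      move=> s /andP[as_ sT]; have s0 : 0 < s by exact: lt_le_trans as_.
      apply: le_trans (bound nu s nu0 s0 _) _.
        by apply: le_lt_trans nuT1; rewrite ler_pM2l.
      have -> : f s = d * s `^ (- q) by rewrite /f a2q addrAC subrr add0r.
      by rewrite lee_fin /d (powRM _ (ltW nu0) (ltW s0)) powRN invfM mulrA.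
    rewrite lee_fin gerBl; apply: mulr_ge0; last exact: powR_ge0.
    by apply: mulr_ge0; apply: ltW => //; rewrite divr_gt0.
  have -> : [set tau : R | (0 < tau <= T)%R] = `]0%R, T]%classic.
    by apply/seteqP; split => s /=; rewrite in_itv.
  apply: le_trans (lee_wpmul2l _ hI) _; first by rewrite lee_fin ltW.
  rewrite -EFinM lee_fin.
  have -> : nu * F T = c' * (nu * T) `^ (alpha / 2).
    rewrite /F /d /c' (powRM _ (ltW nu0) (ltW T0)) {2}a2q powRD; last by rewrite (gt_eqF nu0) implybT.
    rewrite powRr1 ?ltW// powRN; ring.
  by rewrite ler_wpM2r ?powR_ge0// lerDr ltW.
- move=> C C0 hM.
  (* The modulus at radius [1/4], which is admissible because [1/4 < 1/2]. *)
  pose k := C * `|ln (4^-1 : R)| `^ (- 2^-1).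
  have ln4 : ln (4^-1 : R) < 0 by rewrite ln_lt0//; lra.
  have k0 : 0 < k by rewrite mulr_gt0// powR_gt0// normr_gt0 lt_eqF.
  pose c := 128 ^+ 2 * k * (C * 2).
  have c0 : 0 < c.
    by apply: mulr_gt0; [apply: mulr_gt0; [rewrite exprn_gt0 ?ltr0n|]|
      rewrite mulr_gt0 ?ltr0n].
  have bound nu t : 0 < nu -> 0 < t -> nu * t < 1 ->
      (L2sq (w nu) t <= (c / (nu * t * Num.sqrt `|ln (nu * t)|))%:E)%E.
    move=> nu0 t0 nut1; have x0 : 0 < nu * t by rewrite mulr_gt0.
    have hB : (Momega w (Num.sqrt (nu * t) / 2) <=
        (C * (2 / Num.sqrt `|ln (nu * t)|))%:E)%E.
      apply: (le_trans (hM _ _)).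
        rewrite divr_gt0 ?sqrtr_gt0//= -[ltRHS]mul1r ltr_pM2r ?invr_gt0//.
        by rewrite -sqrtr1 ltr_sqrt.
      by rewrite lee_fin ler_pM2l// ln_half_sqrt// x0.
    have hk : (Momega w 4^-1 <= k%:E)%E by apply: hM; lra.
    apply: le_trans (L2sq_le_Momega nu0 t0 nut1 (sol nu nu0) hB hk) _.
    rewrite lee_fin /c [in leRHS]invfM le_eqVlt; apply/orP; left.
    by apply/eqP; ring.
  split; first by exists c.
  exists c; split => // delta nu T d0 nu0 dT nuT1.
  have T0 : 0 < T by exact: lt_trans dT.
  have lnT : ln (nu * T) < 0 by rewrite ln_lt0// nuT1 mulr_gt0.
  (* For [s <= T] one has [|ln (nu s)| >= |ln (nu T)|], so the logarithm is frozen at its value at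
     [T]. Only [1 / s] remains to be integrated, giving [ln (T / delta)]. *)
  pose S := Num.sqrt `|ln (nu * T)|.
  have S0 : 0 < S by rewrite sqrtr_gt0 normr_gt0 lt_eqF.
  pose e := c / (nu * S).
  pose F t : R := e * ln t.
  pose f t : R := e * t^-1.
  have dF (s : R) : 0 < s -> is_derive s (1 : R) F (f s).
    by move=> s0; exact: is_derive_scale (is_derive1_ln s0) e.
  have cf (s : R) : 0 < s -> {for s, continuous f}.
    by move=> s0; apply: cvgMr; apply: cvgV => //; rewrite gt_eqF.
  have -> : [set tau : R | (delta <= tau <= T)%R] = `[delta, T]%classic.
    by apply/seteqP; split => s /=; rewrite in_itv.
  have hI : (\int[lebesgue_measure]_(tau in `[delta, T]) L2sq (w nu) tau
      <= (F T - F delta)%:E)%E.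
    apply: (@integral_L2sq_le R (w nu) (smooth nu nu0) (dE nu nu0) F f) => //.
    move=> s /andP[ds sT]; have s0 : 0 < s by exact: lt_le_trans ds.
    have nusT : nu * s <= nu * T by rewrite ler_pM2l.
    have lns : ln (nu * s) <= ln (nu * T).
      by rewrite ler_ln ?posrE ?mulr_gt0.
    apply: le_trans (bound nu s nu0 s0 (le_lt_trans nusT nuT1)) _.
    have -> : f s = c / (nu * s * S).
      by rewrite /f /e; move: (c) => c1; field; rewrite !gt_eqF.
    rewrite lee_fin (ler_pM2l c0).
    rewrite lef_pV2 ?posrE ?mulr_gt0//; last first.
      by rewrite sqrtr_gt0 normr_gt0 lt_eqF// (le_lt_trans lns).
    rewrite ler_pM2l ?mulr_gt0// ler_wsqrtr//.
    by rewrite !ltr0_norm ?lerN2// (le_lt_trans lns).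
  apply: le_trans (lee_wpmul2l _ hI) _; first by rewrite lee_fin ltW.
  rewrite -EFinM lee_fin le_eqVlt; apply/orP; left; apply/eqP.
  rewrite ln_div ?posrE// /F /e -/S; field.
  by rewrite !gt_eqF.
Qed.
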